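(* Let $m,n,r$ be positive integers, $\mu\in\mathbb R$, $\sigma>0$, $x>0$, $y\ge 0$. Let $M\in\mathbb R^{m\times n}$ be a fixed nonzero matrix with $r(M)=\operatorname{rank}(M)$. Let $G'\in\mathcal G_{\mu,\sigma}^{r\times m}$ and $H'\in\mathcal G_{\mu,\sigma}^{n\times r}$ be Gaussian random matrices, and let $G=G'+U$ and $H=H'+V$ for some fixed matrices $U\in\mathbb R^{r\times m}$ and $V\in\mathbb R^{n\times r}$. Put $\widehat r=\min\{r,r(M)\}$ and $$F(y,M,\sigma)=2.35\, y\,\sqrt{\widehat r}\;\|M^+\|/\sigma .$$ Then $$F_{1/\|(GM)^+\|}(y)\le F(y,M,\sigma)\quad\text{and}\quad F_{1/\|(MH)^+\|}(y)\le F(y,M,\sigma),$$ that is, $$\mathrm{Probability}\,\{\|P^+\|\ge 2.35\,x\sqrt{\widehat r}\,\|M^+\|/\sigma\}\le 1/x\quad\text{for } P=GM \text{ and for } P=MH.$$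
   Context: All matrices are real. $\|\cdot\|$ is the spectral norm (matrix 2-norm). $A^+$ is the Moore–Penrose pseudo-inverse of $A$; for a matrix $A$ of rank $\rho\ge 1$, $\|A^+\|=1/\sigma_\rho(A)$, where $\sigma_j(A)$ denotes the $j$th largest singular value of $A$. For a real random variable $\gamma$, $F_\gamma(y)=\mathrm{Probability}\{\gamma\le y\}$ is its cumulative distribution function. $\mathcal G_{\mu,\sigma}^{p\times q}$ is the set of $p\times q$ Gaussian random matrices whose entries are independent identically distributed Gaussian random variables, all with mean $\mu$ and variance $\sigma^2>0$. *)

(* Defs.v *)
From HB Require Import structures.
From mathcomp Require Import all_boot all_order all_algebra.
From mathcomp Require Import all_classical all_reals all_analysis.
From mathcomp Require Import measurable_realfun.

Set Implicit Arguments.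
Unset Strict Implicit.
Unset Printing Implicit Defensive.

Import Order.TTheory GRing.Theory Num.Theory.
Import numFieldNormedType.Exports.

Local Open Scope classical_set_scope.
Local Open Scope ring_scope.

Section LinearAlgebra.
Context {R : realType}.

Definition l2norm n (v : 'cV[R]_n) : R := Num.sqrt (\sum_i v i 0 ^+ 2).

(* The norm that MathComp-Analysis puts on matrices is the entrywise maximum,
   so the operator norm induced by the Euclidean norm is defined here. *)
Definition spectral_norm m n (A : 'M[R]_(m, n)) : R :=
  sup [set l2norm (A *m v) | v in [set v : 'cV[R]_n | l2norm v <= 1]].

Definition penrose m n (A : 'M[R]_(m, n)) (X : 'M[R]_(n, m)) : Prop :=
  [/\ A *m X *m A = A, X *m A *m X = X,
      (A *m X)^T = A *m X & (X *m A)^T = X *m A].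

(* MathComp's pinvmx is only some partial inverse; the Moore-Penrose inverse is
   the unique solution of the four Penrose equations (moore_penroseP,
   penrose_inj). *)
Definition moore_penrose m n (A : 'M[R]_(m, n)) : 'M[R]_(n, m) :=
  xget 0 [set X | penrose A X].

Lemma l2norm_ge0 n (v : 'cV[R]_n) : 0 <= l2norm v.
Proof. exact: sqrtr_ge0. Qed.

Lemma l2norm_eq0 n (v : 'cV[R]_n) : l2norm v = 0 -> v = 0.
Proof.
move=> /eqP; rewrite sqrtr_eq0 => h; apply/colP => i; rewrite mxE.
have h0 : \sum_i v i 0 ^+ 2 == 0.
  by rewrite eq_le h sumr_ge0// => j _; exact: sqr_ge0.
move: h0; rewrite psumr_eq0 => [/allP/(_ i)|j _]; last exact: sqr_ge0.
by rewrite mem_index_enum => /(_ isT)/=; rewrite sqrf_eq0 => /eqP.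
Qed.

Lemma l2norm0 n : l2norm (0 : 'cV[R]_n) = 0.
Proof. by rewrite /l2norm big1 ?sqrtr0// => i _; rewrite mxE expr0n. Qed.

Lemma l2normZ n a (v : 'cV[R]_n) : l2norm (a *: v) = `|a| * l2norm v.
Proof.
rewrite /l2norm -sqrtr_sqr -sqrtrM ?sqr_ge0// mulr_sumr.
by congr Num.sqrt; apply: eq_bigr => i _; rewrite mxE exprMn.
Qed.

Lemma coord_le_l2norm n (v : 'cV[R]_n) i : `|v i 0| <= l2norm v.
Proof.
rewrite -sqrtr_sqr ler_sqrt; last by rewrite sumr_ge0// => j _; exact: sqr_ge0.
rewrite (bigD1 i)//= lerDl sumr_ge0// => j _; exact: sqr_ge0.
Qed.

Lemma has_sup_spectral_norm m n (A : 'M[R]_(m, n)) :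
  has_sup [set l2norm (A *m v) | v in [set v : 'cV[R]_n | l2norm v <= 1]].
Proof.
split; first by exists (l2norm (A *m 0)), 0 => //=; rewrite l2norm0.
exists (Num.sqrt (\sum_i (\sum_j `|A i j|) ^+ 2)) => _ [v /= v1 <-].
rewrite ler_wsqrtr// ler_sum// => i _.
rewrite -[leLHS]real_normK ?num_real// lerXn2r ?nnegrE//.
  by rewrite sumr_ge0.
rewrite mxE (le_trans (ler_norm_sum _ _ _))// ler_sum// => j _.
by rewrite normrM ler_piMr// (le_trans (coord_le_l2norm _ _)).
Qed.

Lemma continuous_l2norm_mulmx m n (A : 'M[R]_(m, n)) :
  continuous (fun v : 'cV[R]_n => l2norm (A *m v)).
Proof.
have csum (I : Type) (s : seq I) (F : I -> 'cV[R]_n -> R) :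
    (forall i, continuous (F i)) -> continuous (fun v => \sum_(i <- s) F i v).
  move=> cF; elim: s => [|i s IHs].
    by under eq_fun do rewrite big_nil; exact: cst_continuous.
  under eq_fun do rewrite big_cons; move=> v.
  exact: (@continuousD R R^o _ _ _ v (cF i v) (IHs v)).
have cA i : continuous (fun v : 'cV[R]_n => (A *m v) i 0).
  have -> : (fun v : 'cV[R]_n => (A *m v) i 0) =
            (fun v => \sum_j A i j * v j 0).
    by apply/funext => v; rewrite mxE.
  by apply: csum => j v; apply: continuousM;
    [exact: (@cst_continuous _ R)|exact: coord_continuous].
have cS : continuous (fun v : 'cV[R]_n => \sum_i (A *m v) i 0 ^+ 2).
  apply: csum => i v; exact: (continuous_comp (cA i v) (@exprn_continuous R 2 _)).
by move=> v; exact: (continuous_comp (cS v) (@sqrt_continuous R _)).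
Qed.

Lemma spectral_norm_gtP m n (A : 'M[R]_(m, n)) (c : R) :
  c < spectral_norm A <->
  exists q : 'cV[rat]_n,
    l2norm (map_mx ratr q) <= 1 /\ c < l2norm (A *m map_mx ratr q).
Proof.
split; last first.
  move=> [q [q1 cq]]; apply: (lt_le_trans cq).
  by apply: (ub_le_sup (has_sup_spectral_norm A).2); exists (map_mx ratr q).
move=> /(sup_gt (has_sup_spectral_norm A).1)[_ [v /= v1 <-] cv].
have [c0|c0] := ltP c 0.
  by exists 0; rewrite map_mx0 l2norm0 ler01 (lt_le_trans c0)// l2norm_ge0.
set a := l2norm (A *m v) in cv.
have a0 : 0 < a by exact: le_lt_trans cv.
pose t := (c / a + 1) / 2.
have ca1 : c / a < 1 by rewrite ltr_pdivrMr// mul1r.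
have ca0 : 0 <= c / a by rewrite divr_ge0// ltW.
have [t0 [t1 cta]] : 0 < t /\ t < 1 /\ c < t * a.
  have : c / a < t by rewrite /t midf_lt.
  rewrite ltr_pdivrMr// => ?; split; first by rewrite /t divr_gt0// ltr_wpDl.
  by split => //; rewrite /t midf_lt.
have tv1 : l2norm (1%:M *m (t *: v)) < 1.
  rewrite mul1mx l2normZ gtr0_norm//.
  by rewrite (le_lt_trans _ t1)// ler_piMr// ltW.
have ctv : c < l2norm (A *m (t *: v)) by rewrite -scalemxAr l2normZ gtr0_norm.
have /nbhs_ballP[e1 /= e10 b1] : nbhs (t *: v) [set u | l2norm (1%:M *m u) < 1].
  apply: (@continuous_l2norm_mulmx _ _ 1%:M (t *: v) [set y | y < 1]).
  exact: lt_nbhsl.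
have /nbhs_ballP[e2 /= e20 b2] : nbhs (t *: v) [set u | c < l2norm (A *m u)].
  apply: (@continuous_l2norm_mulmx _ _ A (t *: v) [set y | c < y]).
  exact: lt_nbhsr.
pose e := Num.min e1 e2.
have e0 : 0 < e by rewrite lt_min; apply/andP.
have /choice[q qP] (i : 'I_n) :
    exists q : rat, ball ((t *: v) i 0) e (ratr q).
  have /rat_in_itvoo[q] : (t *: v) i 0 - e < (t *: v) i 0 + e.
    by rewrite ltrBlDr -addrA ltrDl addr_gt0.
  move=> /itvP qi; exists q.
  by rewrite /ball/= ltr_distlC !qi.
have bq (e' : R) : 0 < e' -> e <= e' -> ball (t *: v) e' (map_mx ratr (\col_i q i)).
  move=> e'0 ee'; split => // i j; rewrite (ord1 j) !mxE.
  by have := qP i; rewrite mxE; exact: le_ball.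
exists (\col_i q i); split.
  rewrite ltW//; rewrite -[map_mx _ _]mul1mx; apply: b1; apply: bq => //.
  by rewrite ge_min lexx.
by apply: b2; apply: bq => //; rewrite ge_min lexx orbT.
Qed.

Lemma penrose_inj m n (A : 'M[R]_(m, n)) (X Y : 'M[R]_(n, m)) :
  penrose A X -> penrose A Y -> X = Y.
Proof.
move=> [AXA XAX sAX sXA] [AYA YAY sAY sYA].
have E1 : A *m X = A *m Y.
  have <- : A *m Y *m (A *m X) = A *m X by rewrite mulmxA AYA.
  by rewrite -[LHS]trmxK trmx_mul sAX sAY mulmxA AXA sAY.
have E2 : X *m A = Y *m A.
  have <- : X *m A *m (Y *m A) = X *m A by rewrite -!mulmxA (mulmxA A) AYA.
  by rewrite -[LHS]trmxK trmx_mul sXA sYA -!mulmxA (mulmxA A) AXA sYA.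
by rewrite -XAX E2 -mulmxA E1 mulmxA.
Qed.

Lemma gram_unit k n (B : 'M[R]_(k, n)) : row_free B -> B *m B^T \in unitmx.
Proof.
move=> rB; rewrite -row_free_unit; apply: inj_row_free => v vBB.
apply/eqP; rewrite -(mulmx_free_eq0 _ rB); apply/eqP/trmx_inj.
rewrite trmx0; apply: l2norm_eq0; rewrite /l2norm.
rewrite (_ : \sum_i _ = (v *m B *m (v *m B)^T) 0 0).
  by rewrite trmx_mul mulmxA -(mulmxA v) vBB mul0mx mxE sqrtr0.
by rewrite mxE; apply: eq_bigr => i _; rewrite ![_^T _ _]mxE expr2.
Qed.

Lemma penrose_factor m n k (C : 'M[R]_(m, k)) (B : 'M[R]_(k, n)) :
  C^T *m C \in unitmx -> B *m B^T \in unitmx ->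
  penrose (C *m B)
    (B^T *m invmx (B *m B^T) *m invmx (C^T *m C) *m C^T).
Proof.
move=> uC uB; set I2 := invmx (B *m B^T); set I1 := invmx (C^T *m C).
set X := _ *m C^T.
have AX : C *m B *m X = C *m I1 *m C^T.
  by rewrite /X -!mulmxA; congr (_ *m _); rewrite !mulmxA mulmxV// mul1mx.
have XA : X *m (C *m B) = B^T *m I2 *m B.
  rewrite /X !mulmxA; congr (_ *m _).
  by rewrite -!mulmxA mulVmx// mulmx1.
split.
- by rewrite AX -!mulmxA (mulmxA C^T) (mulmxA I1) mulVmx// mul1mx.
- by rewrite XA /X -!mulmxA (mulmxA B) (mulmxA (B *m B^T)) mulmxV// mul1mx.
- by rewrite AX !trmx_mul trmxK trmx_inv trmx_mul trmxK mulmxA.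
- by rewrite XA !trmx_mul trmxK trmx_inv trmx_mul trmxK mulmxA.
Qed.

Lemma penrose_rowsub m n (A : 'M[R]_(m, n)) :
  exists k (f : {ffun 'I_k -> 'I_m}),
    let B := rowsub f A in let C := A *m B^T *m invmx (B *m B^T) in
    [/\ B *m B^T \in unitmx, C^T *m C \in unitmx & A = C *m B].
Proof.
exists (\rank A), (maxrankfun A) => B.
have rB : row_free B by exact: maxrowsub_free.
have uB := gram_unit rB.
move=> C.
have AE : A = C *m B.
  have /submxP[D AD] : (A <= B)%MS by rewrite eq_maxrowsub.
  have : D *m B *m B^T *m invmx (B *m B^T) *m B = D *m B.
    by rewrite -(mulmxA D) -(mulmxA D) mulmxV// mulmx1.
  by rewrite -AD => ->.
split => //; rewrite -{2}[C]trmxK; apply: gram_unit.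
rewrite /row_free mxrank_tr eqn_leq rank_leq_col/=.
by have := mxrankM_maxl C B; rewrite -AE.
Qed.

Lemma moore_penroseP m n (A : 'M[R]_(m, n)) : penrose A (moore_penrose A).
Proof.
have [k [f /= [uB uC AE]]] := penrose_rowsub A.
have := penrose_factor uC uB; rewrite -AE => h.
exact: (@xgetPex _ 0 [set X | penrose A X] (ex_intro _ _ h)).
Qed.

Lemma moore_penrose_eq m n (A : 'M[R]_(m, n)) X :
  penrose A X -> moore_penrose A = X.
Proof. exact: penrose_inj (moore_penroseP A). Qed.

End LinearAlgebra.

Section Measurability.
Context {d : measure_display} {T : measurableType d} {R : realType}.
Local Notation rmx := (matrix {mfun T >-> R}).

(* A random matrix is a matrix of random variables; sums and products of random
   matrices are those of matrices over the ring of measurable functions, which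
   are computed pointwise (realizeD, realizeM). *)
Definition realize p q (A : rmx p q) (w : T) : 'M[R]_(p, q) :=
  map_mx (fun X : {mfun T >-> R} => X w) A.

Definition eval_rv (w : T) (X : {mfun T >-> R}) : R := X w.

Let eval_rv_zmod w : zmod_morphism (eval_rv w). Proof. by []. Qed.
Let eval_rv_monoid w : monoid_morphism (eval_rv w). Proof. by []. Qed.
HB.instance Definition _ w :=
  GRing.isZmodMorphism.Build {mfun T >-> R} R (eval_rv w) (eval_rv_zmod w).
HB.instance Definition _ w :=
  GRing.isMonoidMorphism.Build {mfun T >-> R} R (eval_rv w) (eval_rv_monoid w).

Lemma realizeD p q (A B : rmx p q) w :
  realize (A + B) w = realize A w + realize B w.
Proof. exact: (map_mxD (eval_rv w)). Qed.

Lemma realizeM p q s (A : rmx p q) (B : rmx q s) w :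
  realize (A *m B) w = realize A w *m realize B w.
Proof. exact: (map_mxM (eval_rv w)). Qed.

Lemma measurable_invr : measurable_fun [set: R] (@GRing.inv R).
Proof.
have D0 : open [set x : R | x != 0] by exact: open_neq.
rewrite (_ : [set: R] = [set x : R | x != 0] `|` [set 0]); last first.
  by apply/seteqP; split => // x _; have [->|?] := eqVneq x 0; [right|left].
apply/measurable_funU => //; first exact: open_measurable.
split; last exact: measurable_fun_set1.
apply: open_continuous_measurable_fun => // x; rewrite inE/= => x0.
exact: inv_continuous.
Qed.

Lemma measurable_mfunV (X : {mfun T >-> R}) :
  measurable_fun [set: T] (fun w => (X w)^-1).
Proof. by apply: (measurableT_comp measurable_invr). Qed.

Definition mfunV (X : {mfun T >-> R}) : {mfun T >-> R} :=
  mfun_Sub (mem_set (measurable_mfunV X)).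

Let rmxV n (A : rmx n n) : rmx n n := mfunV (\det A) *: \adj A.

Let realizeV n (A : rmx n n) w : realize A w \in unitmx ->
  realize (rmxV A) w = invmx (realize A w).
Proof.
move=> uA; rewrite /invmx uA.
transitivity (eval_rv w (mfunV (\det A)) *: map_mx (eval_rv w) (\adj A)).
  exact: (map_mxZ (eval_rv w)).
rewrite (map_mx_adj (eval_rv w)); congr (_ *: _).
by rewrite (det_map_mx (eval_rv w)).
Qed.

Let rpinv p q (A : rmx p q) k (f : {ffun 'I_k -> 'I_p}) : rmx q p :=
  let B := rowsub f A in
  let C := A *m B^T *m rmxV (B *m B^T) in
  B^T *m rmxV (B *m B^T) *m rmxV (C^T *m C) *m C^T.

Let rpinvP p q (A : rmx p q) w :
  exists k (f : {ffun 'I_k -> 'I_p}),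
    moore_penrose (realize A w) = realize (rpinv A f) w.
Proof.
have [k [f /= [uB uC AE]]] := penrose_rowsub (realize A w).
exists k, f; apply: moore_penrose_eq.
have rB : rowsub f (realize A w) = realize (rowsub f A) w.
  by rewrite /realize map_mxsub.
have rT p' q' (A' : rmx p' q') : realize A'^T w = (realize A' w)^T.
  by rewrite /realize map_trmx.
have uB' : realize (rowsub f A *m (rowsub f A)^T) w \in unitmx.
  by rewrite realizeM rT -rB.
set B := rowsub f A in uB' *; set C := A *m B^T *m rmxV (B *m B^T).
have rC : realize C w = realize A w *m (rowsub f (realize A w))^T *m
    invmx (rowsub f (realize A w) *m (rowsub f (realize A w))^T).
  by rewrite !realizeM (realizeV uB') realizeM rT rB.
have uC' : realize (C^T *m C) w \in unitmx by rewrite realizeM rT rC.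
have := penrose_factor uC uB; rewrite -AE -rC rB.
have -> : realize (rpinv A f) w =
    (realize B w)^T *m invmx (realize B w *m (realize B w)^T) *m
    invmx ((realize C w)^T *m realize C w) *m (realize C w)^T.
  rewrite -!rT -!realizeM -(realizeV uB') -(realizeV uC') -!realizeM.
  by [].
by [].
Qed.

Let measurable_zero p q (A : rmx p q) : measurable [set w | realize A w = 0].
Proof.
rewrite (_ : [set w | _] =
  \bigcap_(i in [set: 'I_p]) \bigcap_(j in [set: 'I_q]) (A i j @^-1` [set 0])).
  apply: fin_bigcap_measurable => // i _.
  by apply: fin_bigcap_measurable => // j _; rewrite -[X in measurable X]setTI;
    exact: measurable_funP.
apply/seteqP; split => w /=.
  by move=> /matrixP A0 i _ j _; have := A0 i j; rewrite !mxE.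
by move=> A0; apply/matrixP => i j; rewrite !mxE; exact: A0.
Qed.

Lemma measurable_moore_penrose p q (A : rmx p q) i j :
  measurable_fun [set: T] (fun w => moore_penrose (realize A w) i j).
Proof.
have mE k (f : {ffun 'I_k -> 'I_p}) :
    measurable [set w | moore_penrose (realize A w) = realize (rpinv A f) w].
  move: (rpinv A f) => X.
  rewrite (_ : [set w | _] =
    [set w | realize (A *m X *m A - A) w = 0] `&`
    [set w | realize (X *m A *m X - X) w = 0] `&`
    [set w | realize ((A *m X)^T - A *m X) w = 0] `&`
    [set w | realize ((X *m A)^T - X *m A) w = 0]).
    by do 3?apply: measurableI; exact: measurable_zero.
  have rB p' q' (A1 A2 : rmx p' q') w :
      realize (A1 - A2) w = 0 <-> realize A1 w = realize A2 w.
    have -> : realize (A1 - A2) w = realize A1 w - realize A2 w.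
      exact: (map_mxB (eval_rv w)).
    by split=> [/subr0_eq|->//]; rewrite ?subrr.
  have rT p' q' (A' : rmx p' q') w : realize A'^T w = (realize A' w)^T.
    by rewrite /realize map_trmx.
  apply/seteqP; split => w /=.
    move=> E; have [e1 e2 e3 e4] := moore_penroseP (realize A w).
    by split; [split; [split|]|]; apply/rB; rewrite ?rT !realizeM -E.
  move=> [[[/rB e1 /rB e2] /rB e3] /rB e4]; apply: moore_penrose_eq.
  by move: e1 e2 e3 e4; rewrite ?rT !realizeM; split.
move=> _ Y mY; rewrite setTI.
rewrite (_ : _ @^-1` Y = \bigcup_(k : nat) \bigcup_(f : {ffun 'I_k -> 'I_p})
   ([set w | moore_penrose (realize A w) = realize (rpinv A f) w] `&`
    (rpinv A f i j @^-1` Y))).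
  apply: bigcupT_measurable => k; apply: fin_bigcup_measurable => // f _.
  apply: measurableI; first exact: mE.
  by rewrite -[X in measurable X]setTI; exact: measurable_funP.
apply/seteqP; split => w /=.
  have [k [f E]] := rpinvP A w; rewrite E => Yw.
  by exists k => //; exists f => //; split => //; move: Yw; rewrite mxE.
by move=> [k _ [f _ [/= -> Yw]]]; rewrite mxE.
Qed.

Lemma measurable_spectral_norm p q (A : rmx p q) :
  measurable_fun [set: T] (fun w => spectral_norm (realize A w)).
Proof.
move=> mT; apply: (measurability _ (RGenOInfty.measurableE R)) => //.
move=> /= _ [_ [c ->] <-]; rewrite setTI.
rewrite (_ : _ @^-1` _ = \bigcup_(v : 'cV[rat]_q)
    [set w | l2norm (map_mx ratr v : 'cV[R]_q) <= 1 /\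
             c < l2norm (realize A w *m map_mx ratr v)]).
  apply: countable_bigcupT_measurable => [|v]; first exact: countableP.
  have [v1|v1] := pselect (l2norm (map_mx ratr v : 'cV[R]_q) <= 1); last first.
    by rewrite (_ : [set w | _] = set0)//; apply/seteqP; split => w // -[].
  rewrite (_ : [set w | _] =
    (fun w => l2norm (realize A w *m map_mx ratr v)) @^-1` `]c, +oo[); last first.
    by apply/seteqP; split => w /=; rewrite in_itv/= andbT; [case|split].
  rewrite -[X in measurable X]setTI.
  suff : measurable_fun [set: T]
      (fun w => l2norm (realize A w *m map_mx ratr v)) by exact.
  have mj i : measurable_fun [set: T]
      (fun w => (realize A w *m (map_mx ratr v : 'cV[R]_q)) i 0).
    rewrite (_ : (fun w => _) = (fun w => \sum_j A i j w * ratr (v j 0))).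
      apply: measurable_sum => j; apply: measurable_funM => //.
    by apply/funext => w; rewrite mxE; apply: eq_bigr => j _; rewrite !mxE.
  have mS : measurable_fun [set: R] (@Num.sqrt R).
    by apply: continuous_measurable_fun; exact: sqrt_continuous.
  apply: (measurableT_comp mS) => //.
  by apply: measurable_sum => i; exact: measurable_funX.
apply/seteqP; split => w /=.
  by rewrite in_itv/= andbT => /spectral_norm_gtP[v vP]; exists v.
by move=> [v _ vP]; rewrite in_itv/= andbT; apply/spectral_norm_gtP; exists v.
Qed.

Let rmoore_penrose p q (A : rmx p q) : rmx q p :=
  \matrix_(i, j) mfun_Sub (mem_set (measurable_moore_penrose A i j)).

Lemma measurable_norm_moore_penrose p q (A : rmx p q) :
  measurable_fun [set: T] (fun w => spectral_norm (moore_penrose (realize A w))).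
Proof.
have := measurable_spectral_norm (rmoore_penrose A).
congr (measurable_fun _ _); apply/funext => w; congr spectral_norm.
by apply/matrixP => i j; rewrite !mxE.
Qed.

End Measurability.

Section RandomMatrices.
Context {d : measure_display} {T : measurableType d} {R : realType}.

(* As 0^-1 = 0 in R, the reciprocal is 0 where X vanishes. *)
Definition recip_rv (P : probability T R) (X : {RV P >-> R}) : {RV P >-> R} :=
  mfunV X.

Definition const_rmx (P : probability T R) p q (A : 'M[R]_(p, q)) :
    'M[{RV P >-> R}]_(p, q) :=
  map_mx (fun a => cst a : {mfun T >-> R}) A.

Definition norm_pinv_rv (P : probability T R) p q
    (A : 'M[{RV P >-> R}]_(p, q)) : {RV P >-> R} :=
  mfun_Sub (mem_set (measurable_norm_moore_penrose A)).

Lemma recip_rvE (P : probability T R) (X : {RV P >-> R}) w :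
  recip_rv X w = (X w)^-1.
Proof. by []. Qed.

Lemma realize_const_rmx (P : probability T R) p q (A : 'M[R]_(p, q)) w :
  realize (const_rmx P A) w = A.
Proof. by apply/matrixP => i j; rewrite !mxE. Qed.

Lemma norm_pinv_rvE (P : probability T R) p q
    (A : 'M[{RV P >-> R}]_(p, q)) w :
  norm_pinv_rv A w = spectral_norm (moore_penrose (realize A w)).
Proof. by []. Qed.

Definition mutually_independent (P : probability T R) (I : finType)
    (X : I -> {RV P >-> R}) : Prop :=
  forall (J : {set I}) (B : I -> set R),
    (forall i, i \in J -> measurable (B i)) ->
    P (\bigcap_(i in [set` J]) (X i @^-1` B i)) =
    (\prod_(i in J) P (X i @^-1` B i))%E.

(* normal_prob takes the standard deviation, not the variance. *)
Definition gaussian_matrix (P : probability T R) p q (mu sigma : R)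
    (G : 'M[{RV P >-> R}]_(p, q)) : Prop :=
  mutually_independent (fun ij : 'I_p * 'I_q => G ij.1 ij.2) /\
  forall (i : 'I_p) (j : 'I_q) (B : set R), measurable B ->
    distribution P (G i j) B = normal_prob mu sigma B.

End RandomMatrices.

(* Main.v *)
(* The argument of Sankar, Spielman and Teng, with a Gaussian test vector in place
   of a random point of the sphere. Consider X = (L B N)^+ L with B Gaussian, L and N
   fixed, rank L <= rank N, and let p be a standard Gaussian vector independent of B.
   For fixed X, |X p| >= (3/4) |X| with probability at least P(|g| > 3/4), where g is
   a standard Gaussian variable. For fixed p, rotate B so that the projection p' of p
   on the row space of L becomes a multiple of the first basis vector: given all rows
   of the rotated B but the first, there is a unit vector q in the range of N such that
   |X p| <= |p'| |N^+| / |<row_0, q>|, and <row_0, q> is Gaussian, hence has density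
   at most 1 / (sigma sqrt(2 pi)). Tonelli combines the two estimates, since the mean
   of |p'| is at most sqrt(rank L), and sqrt(2/pi) / ((3/4) P(|g| > 3/4)) < 2.35.
   For P = G M, the case r <= rank M is L = 1, N = M; the case rank M < r is
   L = M^T, B = G^T, N = 1, because |(GM)^+| <= |(M^T G^T)^+ M^T| |M^+|. *)

Require Import Defs.
From HB Require Import structures.
From mathcomp Require Import all_boot all_order all_algebra.
From mathcomp Require Import all_classical all_reals all_analysis.
From mathcomp Require Import measurable_realfun.
From mathcomp Require Import ring lra.

Set Implicit Arguments.
Unset Strict Implicit.
Unset Printing Implicit Defensive.

Import Order.TTheory GRing.Theory Num.Theory.
Import numFieldNormedType.Exports.

Local Open Scope classical_set_scope.
Local Open Scope ring_scope.

(** * The normal distribution *)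

(** The constant 2.35 leaves almost no room: c P(|g| > c) is largest near c = 3/4, where sqrt(2/pi)
    / (c P(|g| > c)) is about 2.347. Hence the sharp numerical bounds on pi and on the normal
    integral, and hence a loss of only one part in 2997 when a unit vector nearly realizing a norm
    replaces a singular vector.

    The vector q has to be found without the first row of the rotated B. Removing p' from the row
    space of L leaves at most rank L - 1 linear conditions on q, which ranges over a space of
    dimension rank N; this is where rank L <= rank N enters, and why the two cases choose L and N
    differently.

    Rotation invariance serves only to carry one vector to a multiple of the first basis vector, so
    it is proved for rotations of two coordinates and then composed. Plane rotations reduce to
    shears, hence to translations of the line. Conditioning is expressed on product spaces: laws of
    finite families are determined by boxes, so coordinates may be replaced by independent copies
    and Tonelli applied. *)

Section Density.
Local Open Scope ereal_scope.
Context d (T : measurableType d) (R : realType).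
Variables (nu mu : {measure set T -> \bar R}) (g : T -> R).
Hypotheses (g0 : forall x, (0 <= g x)%R) (mg : measurable_fun [set: T] g).
Hypothesis nuE : forall A, measurable A -> nu A = \int[mu]_(x in A) (g x)%:E.

Import HBNNSimple.

(** By linearity the identity passes from indicators, where it is [nuE], to simple functions, and by
    monotone convergence to [f]. It turns integrals against [normal_prob], given as a set function,
    into Lebesgue integrals. *)
Lemma ge0_integral_density (f : T -> \bar R) : (forall x, 0 <= f x) ->
  measurable_fun [set: T] f -> \int[nu]_x f x = \int[mu]_x (f x * (g x)%:E).
Proof.
move=> f0 mf; pose h := nnsfun_approx measurableT mf.
have hf x : (EFin \o h n) x @[n --> \oo] --> f x.
  by apply: cvg_nnsfun_approx.
have nd x : {homo (fun n => h n x) : m n / (m <= n)%N >-> (m <= n)%R}.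
  by move=> m n mn; exact/lefP/nd_nnsfun_approx.
transitivity (lim (\int[nu]_x (EFin \o h n) x @[n --> \oo])).
  rewrite -monotone_convergence//.
  - by apply: eq_integral => x _; apply/esym/cvg_lim => //; exact: hf.
  - by move=> n; exact/measurable_EFinP.
  - by move=> n x _; rewrite lee_fin.
  - by move=> x _ m n mn; rewrite lee_fin; exact: nd.
transitivity (lim (\int[mu]_x ((EFin \o h n) x * (g x)%:E) @[n --> \oo])); last first.
  rewrite -monotone_convergence//.
  - apply: eq_integral => x _; apply/cvg_lim => //.
    by apply: cvgeZr => //; exact: hf.
  - by move=> n; apply: emeasurable_funM; exact/measurable_EFinP.
  - by move=> n x _; rewrite mule_ge0 ?lee_fin.
  - by move=> x _ m n mn; rewrite lee_wpmul2r ?lee_fin//; exact: nd.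
apply/congr_lim/funext => n.
transitivity (\int[nu]_x
    (\sum_(y \in range (h n)) (y * \1_(h n @^-1` [set y]) x)%:E)).
  by apply: eq_integral => t tE; rewrite /= fimfunE -fsumEFin.
have indich r : measurable_fun setT (fun x => (r * \1_(h n @^-1` [set r]) x)%:E).
  by apply/measurable_EFinP; exact: measurable_funM.
rewrite ge0_integral_fsum//; last by move=> m y Ey; exact: nnfun_muleindic_ge0.
transitivity (\int[mu]_x (\sum_(y \in range (h n))
    (y * \1_(h n @^-1` [set y]) x)%:E * (g x)%:E)); last first.
  apply: eq_integral => x xE.
  rewrite -ge0_mule_fsuml => [|y]; last exact: nnfun_muleindic_ge0.
  by rewrite fsumEFin // -(fimfunE _ x).
rewrite ge0_integral_fsum//; last 2 first.
  - by move=> y; apply: emeasurable_funM => //; exact/measurable_EFinP.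
  - by move=> m y Ey; rewrite mule_ge0 ?lee_fin// -lee_fin nnfun_muleindic_ge0.
apply: eq_fsbigr => r rhn.
under [LHS]eq_integral do rewrite EFinM.
rewrite integralZl_indic_nnsfun => //.
under [RHS]eq_integral do rewrite EFinM -muleA.
rewrite ge0_integralZl//.
- under [in RHS]eq_integral do rewrite muleC.
  rewrite [in RHS](eq_integral ((EFin \o g) \_ (h n @^-1` [set r]))); last first.
    by move=> x xE; rewrite epatch_indic.
  rewrite -integral_mkcondr setTI -nuE//.
  by rewrite integral_indic// setIT.
- by apply: emeasurable_funM; exact/measurable_EFinP.
- by move=> t Et; rewrite mule_ge0 ?lee_fin.
- by move: rhn; rewrite inE => -[t _ <-]; rewrite lee_fin.
Qed.

End Density.

Section Normal.
Context {R : realType}.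
Implicit Types (s : R).
Notation leb := (@lebesgue_measure R).

Lemma ge0_integral_normal_prob s (f : R -> \bar R) :
  (forall x, 0 <= f x)%E -> measurable_fun [set: R] f ->
  (\int[normal_prob 0%R s]_x f x = \int[leb]_x (f x * (normal_pdf 0 s x)%:E))%E.
Proof.
move=> f0 mf; apply: ge0_integral_density => //.
- by move=> x; exact: normal_pdf_ge0.
- exact: measurable_normal_pdf.
Qed.

Lemma measurable_translate (c : R) :
  measurable_fun [set: R] (fun x : R => x + c : measurableTypeR R).
Proof. exact: measurable_funD. Qed.

Definition translate (c : R) : {mfun R >-> measurableTypeR R} :=
  mfun_Sub (mem_set (measurable_translate c)).

Lemma lebesgue_measure_translate (c : R) (A : set R) : measurable A ->
  pushforward leb (translate c) A = leb A.
Proof.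
move=> mA; apply/esym/lebesgue_measure_unique => //=.
  exact: measurable_translate.
move=> mc _ [[a b]] _ <-.
rewrite /pushforward.
have -> : +%R^~ c @^-1` `]a, b] = `]a - c, b - c]%classic.
  by apply/seteqP; split=> x /=; rewrite !in_itv/= ltrBlDr lerBrDr.
rewrite !lebesgue_measure_itv/= !lte_fin ltrD2r -!EFinD.
by congr (if _ then _ else _); congr (_%:E); ring.
Qed.

Lemma ge0_integral_translate (c : R) (f : R -> \bar R) :
  (forall x, 0 <= f x)%E -> measurable_fun [set: R] f ->
  (\int[leb]_x f (x + c)%R = \int[leb]_x f x)%E.
Proof.
move=> f0 mf.
transitivity (\int[pushforward leb (translate c)]_x f x)%E.
  by rewrite ge0_integral_pushforward//; exact: measurable_translate.
apply: eq_measure_integral => //=; first exact: measurable_translate.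
move=> mc A mA _; exact: lebesgue_measure_translate.
Qed.

End Normal.

(** * Invariance of plane Lebesgue integrals under rotations *)

Section Rotation.
Context {R : realType}.
Notation leb := (@lebesgue_measure R).
Local Open Scope ereal_scope.

Lemma ge0_integral_shear_snd (t : R) (F : R * R -> \bar R) :
  (forall z, 0 <= F z) -> measurable_fun [set: R * R] F ->
  \int[leb]_x \int[leb]_y F (x, y + t * x)%R = \int[leb]_x \int[leb]_y F (x, y).
Proof.
move=> F0 mF; apply: eq_integral => x _.
rewrite (ge0_integral_translate _ (f := fun y => F (x, y)))//.
by apply: measurableT_comp.
Qed.

Lemma ge0_integral_shear_fst (t : R) (F : R * R -> \bar R) :
  (forall z, 0 <= F z) -> measurable_fun [set: R * R] F ->
  \int[leb]_x \int[leb]_y F (x + t * y, y)%R = \int[leb]_x \int[leb]_y F (x, y).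
Proof.
move=> F0 mF; pose Ft (z : R * R) := F (z.1 + t * z.2, z.2)%R.
have mFt : measurable_fun [set: R * R] Ft.
  apply: measurableT_comp => //; apply/measurable_fun_pairP; split => /=.
    by apply: measurable_funD => //; apply: measurable_funM.
  exact: measurable_snd.
have tonelli (H : R * R -> \bar R) : (forall z, 0 <= H z) ->
    measurable_fun [set: R * R] H ->
    \int[leb]_x \int[leb]_y H (x, y) = \int[leb]_y \int[leb]_x H (x, y).
  move=> H0 mH.
  exact: (@fubini_tonelli _ _ (measurableTypeR R) (measurableTypeR R) _ leb leb H).
transitivity (\int[leb]_y \int[leb]_x Ft (x, y)).
  by apply: (tonelli Ft) => // z; exact: F0.
transitivity (\int[leb]_y \int[leb]_x F (x, y)); last by apply/esym/tonelli.
apply: eq_integral => y _.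
apply: (ge0_integral_translate (t * y)%R (f := fun x => F (x, y))) => //.
by apply: measurableT_comp.
Qed.

Variables (al be : R).
Hypotheses (ab1 : (al ^+ 2 + be ^+ 2 = 1)%R) (alN1 : al != (-1)%R).

Definition rotation (z : R * R) : R * R :=
  (al * z.1 - be * z.2, be * z.1 + al * z.2)%R.

Lemma measurable_rotation : measurable_fun [set: R * R] rotation.
Proof.
apply/measurable_fun_pairP; split => /=.
  by apply: measurable_funB; apply: measurable_funM.
by apply: measurable_funD; apply: measurable_funM.
Qed.

(* A rotation by an angle other than pi is a product of three shears. *)
Lemma ge0_integral_rotation (F : R * R -> \bar R) :
  (forall z, 0 <= F z) -> measurable_fun [set: R * R] F ->
  \int[leb]_x \int[leb]_y F (rotation (x, y)) = \int[leb]_x \int[leb]_y F (x, y).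
Proof.
move=> F0 mF; have a1 : (1 + al != 0)%R by rewrite addrC -[1%R]opprK subr_eq0.
(* With [al] = cos a and [be] = sin a, [t] is - tan(a/2): the horizontal shear by [t] is used twice,
   around the vertical shear by [be]. The angle pi is where the tangent is infinite. *)
pose t : R := (- (be / (1 + al)))%R.
have mS (u : R) : measurable_fun [set: R * R] (fun z : R * R => (z.1, z.2 + u * z.1)%R).
  apply/measurable_fun_pairP; split; first exact: measurable_fst.
  by apply: measurable_funD => //; apply: measurable_funM.
have mS' (u : R) : measurable_fun [set: R * R] (fun z : R * R => (z.1 + u * z.2, z.2)%R).
  apply/measurable_fun_pairP; split; last exact: measurable_snd.
  by apply: measurable_funD => //; apply: measurable_funM.
have tu : (t * (1 + al) = - be)%R by rewrite /t mulNr divfK.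
have tb : (t * be = al - 1)%R.
  apply: (mulIf a1); rewrite mulrAC tu mulNr -expr2.
  by rewrite (_ : be ^+ 2 = 1 - al ^+ 2)%R; [ring|rewrite -ab1; ring].
have S1 := ge0_integral_shear_fst t F0 mF.
pose F1 (z : R * R) := F (z.1 + t * z.2, z.2)%R.
have mF1 : measurable_fun setT F1 by exact: measurableT_comp.
have S2 := ge0_integral_shear_snd be (fun z => F0 _ : 0 <= F1 z) mF1.
pose F2 (z : R * R) := F1 (z.1, z.2 + be * z.1)%R.
have mF2 : measurable_fun setT F2 by exact: measurableT_comp.
have S3 := ge0_integral_shear_fst t (fun z => F0 _ : 0 <= F2 z) mF2.
rewrite -S1 -[RHS]S2 -[RHS]S3.
apply: eq_integral => x _; apply: eq_integral => y _.
rewrite /F2 /F1 /rotation /=; congr (F (_, _)).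
  have -> : (x + t * y + t * (y + be * (x + t * y)) =
             x * (1 + t * be) + y * (t * (2 + t * be)))%R by ring.
  by rewrite tb (_ : 2 + (al - 1) = 1 + al)%R ?tu; ring.
have -> : (y + be * (x + t * y) = be * x + (1 + t * be) * y)%R by ring.
by rewrite tb; ring.
Qed.

End Rotation.

(** * The centred normal law: rotations, small balls, second moment *)

Section NormalProb.
Context {R : realType}.
Notation leb := (@lebesgue_measure R).
Variable s : R.
Hypothesis s0 : 0 < s.
Notation gam := (normal_prob (0 : R) s).

Lemma normal_pdf0E x : normal_pdf 0 s x = normal_peak s * expR (- (x ^+ 2 / (s ^+ 2 *+ 2))).
Proof. by rewrite normal_pdfE ?gt_eqF// /normal_fun subr0 mulNr. Qed.

Lemma normal_pdfM_rotation al be (z : R * R) : al ^+ 2 + be ^+ 2 = 1 ->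
  normal_pdf 0 s (rotation al be z).1 * normal_pdf 0 s (rotation al be z).2 =
  normal_pdf 0 s z.1 * normal_pdf 0 s z.2.
Proof.
move=> ab1; rewrite !normal_pdf0E mulrACA [RHS]mulrACA -!expRD.
congr (_ * expR _); rewrite -!opprD -!mulrDl; congr (- (_ / _)) => /=.
transitivity ((al ^+ 2 + be ^+ 2) * (z.1 ^+ 2 + z.2 ^+ 2)); first by ring.
by rewrite ab1 mul1r.
Qed.

Local Open Scope ereal_scope.

Lemma measurable_normal_pdf2 : measurable_fun [set: R * R]
  (fun z : R * R => (normal_pdf 0 s z.1 * normal_pdf 0 s z.2)%:E).
Proof.
apply/measurable_EFinP; apply: measurable_funM.
  by apply: measurableT_comp => //; exact: measurable_normal_pdf.
by apply: measurableT_comp => //; exact: measurable_normal_pdf.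
Qed.

Lemma normal_prob_productE (A : set (R * R)) : measurable A ->
  (gam \x gam) A = \int[leb]_x \int[leb]_y
    ((\1_A (x, y))%:E * (normal_pdf 0 s x * normal_pdf 0 s y)%:E).
Proof.
move=> mA.
have mI : measurable_fun [set: R * R] (fun z => (\1_A z)%:E : \bar R).
  by apply/measurable_EFinP; exact: measurable_indic.
have mp : measurable_fun [set: R] (fun y => (normal_pdf 0 s y)%:E).
  by apply/measurable_EFinP; exact: measurable_normal_pdf.
pose f z : \bar R := (\1_A z)%:E * (normal_pdf 0 s z.2)%:E.
have mf : measurable_fun [set: R * R] f.
  by apply: emeasurable_funM => //; apply: (measurableT_comp mp).
have f0 z : 0 <= f z by rewrite mule_ge0// lee_fin// normal_pdf_ge0.
transitivity (\int[gam]_x \int[leb]_y f (x, y)).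
  apply: eq_integral => x _; rewrite /= /normal_prob integral_mkcond.
  apply: eq_integral => y _; rewrite epatch_indic muleC /f; congr (_%:E * _).
  by rewrite !indicE mem_xsection.
rewrite ge0_integral_normal_prob; last 2 first.
- by move=> x; apply: integral_ge0 => y _; exact: f0.
- exact: (@measurable_fun_fubini_tonelli_F _ _ (measurableTypeR R) (measurableTypeR R) _ leb f).
apply: eq_integral => x _; rewrite -ge0_integralZr//.
- by apply: eq_integral => y _; rewrite /f/= -muleA -EFinM [(_ * normal_pdf 0 s x)%R]mulrC.
- exact: (measurableT_comp mf).
- by rewrite lee_fin normal_pdf_ge0.
Qed.

(** The product density depends only on the Euclidean norm, and rotations preserve Lebesgue measure.
    Rectangles suffice, since laws of families are tested on boxes. *)
Lemma normal_prob_rotation al be (A B : set R) : (al ^+ 2 + be ^+ 2 = 1)%R ->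
  al != (-1)%R -> measurable A -> measurable B ->
  (gam \x gam) (rotation al be @^-1` (A `*` B)) = gam A * gam B.
Proof.
move=> ab1 alN1 mA mB; have mAB := measurableX mA mB.
have mr := measurable_rotation al be.
have mrAB : measurable (rotation al be @^-1` (A `*` B)).
  by rewrite -[X in measurable X]setTI; exact: mr.
transitivity ((gam \x gam) (A `*` B)); last exact: product_measure1E.
rewrite (normal_prob_productE mAB) (normal_prob_productE mrAB).
pose F (z : R * R) : \bar R :=
  (\1_(A `*` B) z)%:E * (normal_pdf 0 s z.1 * normal_pdf 0 s z.2)%:E.
have F0 z : 0 <= F z by rewrite mule_ge0// lee_fin// mulr_ge0// normal_pdf_ge0.
have mF : measurable_fun [set: R * R] F.
  apply: emeasurable_funM; last exact: measurable_normal_pdf2.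
  by apply/measurable_EFinP; exact: measurable_indic.
rewrite -[RHS]/(\int[leb]_x \int[leb]_y F (x, y)).
rewrite -[RHS](ge0_integral_rotation ab1 alN1 F0 mF).
apply: eq_integral => x _; apply: eq_integral => y _.
by rewrite /F normal_pdfM_rotation// !indicE.
Qed.

Lemma normal_prob_small_ball (c e : R) : (0 <= e)%R ->
  gam `[(c - e)%R, (c + e)%R]%classic <= (2 * normal_peak s * e)%:E.
Proof.
move=> e0; rewrite /normal_prob.
apply: (@le_trans _ _ (\int[leb]_(x in `[(c - e)%R, (c + e)%R]%classic) (normal_peak s)%:E)).
  apply: ge0_le_integral => //=.
  - by move=> x _; rewrite lee_fin normal_pdf_ge0.
  - by apply/measurable_EFinP/measurable_funTS; exact: measurable_normal_pdf.
  - by move=> x _; rewrite lee_fin normal_pdf_ub// gt_eqF.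
rewrite integral_cst//= lebesgue_measure_itv/= lte_fin.
case: ifPn => _; last by rewrite mule0 lee_fin !mulr_ge0// normal_peak_ge0.
by rewrite -EFinB -EFinM lee_fin le_eqVlt; apply/orP; left; apply/eqP; ring.
Qed.

Lemma normal_peakM (t : R) : (0 < t)%R ->
  normal_peak (s * t) = (normal_peak s / t)%R.
Proof.
move=> t0; rewrite /normal_peak -invfM; congr (_^-1)%R.
rewrite (_ : ((s * t) ^+ 2 * pi *+ 2 = t ^+ 2 * (s ^+ 2 * pi *+ 2))%R); last by ring.
by rewrite sqrtrM ?sqr_ge0// sqrtr_sqr gtr0_norm// mulrC.
Qed.

(* Comparing the density of standard deviation s with that of standard
   deviation s * t through 1 + u <= expR u, and letting t tend to 1. *)
Lemma normal_prob_sqr : \int[gam]_x (x ^+ 2)%:E <= (s ^+ 2)%:E.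
Proof.
have mx2 : measurable_fun [set: measurableTypeR R] (fun x : R => (x ^+ 2)%:E).
  by apply/measurable_EFinP; exact: measurable_funX.
have mp (t : R) : measurable_fun [set: measurableTypeR R] (fun y : R => (normal_pdf 0 t y)%:E).
  by apply/measurable_EFinP; exact: measurable_normal_pdf.
rewrite ge0_integral_normal_prob//; last first.
  by move=> x; rewrite lee_fin sqr_ge0.
set E := integral _ _ _.
have E0 : 0 <= E.
  by apply: integral_ge0 => x _; rewrite mule_ge0// lee_fin ?sqr_ge0 ?normal_pdf_ge0.
have mxp : measurable_fun [set: measurableTypeR R]
    (fun x : R => (x ^+ 2)%:E * (normal_pdf 0 s x)%:E).
  exact: emeasurable_funM.
have p0 (t x : R) : 0 <= (normal_pdf 0 t x)%:E by rewrite lee_fin normal_pdf_ge0.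
have xp0 (x : R) : 0 <= (x ^+ 2)%:E * (normal_pdf 0 s x)%:E.
  by rewrite mule_ge0// lee_fin sqr_ge0.
have key (t : R) : (1 < t)%R ->
    1 + ((1 - t ^- 2) / (s ^+ 2 *+ 2))%:E * E <= t%:E.
  move=> t1; have t0 : (0 < t)%R := lt_trans ltr01 t1.
  set k := (_ / _)%R.
  have k0 : (0 <= k)%R.
    rewrite divr_ge0 ?mulrn_wge0 ?sqr_ge0// subr_ge0 invf_le1 ?exprn_gt0//.
    by rewrite exprn_ege1// ltW.
  have st0 : (0 < s * t)%R by rewrite mulr_gt0.
  have -> : 1 + k%:E * E =
      \int[leb]_x ((normal_pdf 0 s x)%:E + k%:E * ((x ^+ 2)%:E * (normal_pdf 0 s x)%:E)).
    rewrite -[X in X + _](integral_normal_pdf (0%R : R) s).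
    have -> : k%:E * E = \int[leb]_x (k%:E * ((x ^+ 2)%:E * (normal_pdf 0 s x)%:E)).
      by apply/esym/ge0_integralZl.
    apply/esym/ge0_integralD => //; first by move=> x _; rewrite mule_ge0.
    exact: emeasurable_funM.
  have -> : t%:E = \int[leb]_x (t%:E * (normal_pdf 0 (s * t) x)%:E).
    have := integral_normal_pdf (0%R : R) (s * t) => I1.
    by rewrite -[LHS]mule1 -I1; apply/esym/ge0_integralZl => //; rewrite lee_fin ltW.
  apply: ge0_le_integral => //.
  - by move=> x _; rewrite adde_ge0// mule_ge0.
  - by apply: emeasurable_funD => //; exact: emeasurable_funM.
  - exact: emeasurable_funM.
  - move=> x _; rewrite -!EFinM -EFinD lee_fin.
    rewrite (normal_pdfE _ (lt0r_neq0 st0)) normal_peakM// normal_pdf0E.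
    rewrite /normal_fun subr0 mulNr.
    rewrite (_ : forall a b, t * (a / t * b) = a * b)%R; last first.
      by move=> a b; field; rewrite gt_eqF.
    rewrite (_ : (- (x ^+ 2 / ((s * t) ^+ 2 *+ 2)) =
      - (x ^+ 2 / (s ^+ 2 *+ 2)) + k * x ^+ 2)%R); last first.
      rewrite /k; field.
      by rewrite !gt_eqF.
    rewrite expRD.
    set A := expR (- _)%R.
    rewrite (_ : (_ + _ = normal_peak s * (A * (1 + k * x ^+ 2)))%R); last by ring.
    by rewrite !ler_wpM2l ?normal_peak_ge0 ?expR_ge0 ?expR_ge1Dx.
(* [key] gives [E] <= 2 s^2 t^2 / (t + 1), which tends to s^2 as t decreases to 1. Taking t - 1 = e
   / (2 s^2) makes the comparison with s^2 + e reduce to [dd ^+ 2] >= 0. *)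
have E2 (e : R) : (0 < e)%R -> E <= (s ^+ 2 + e)%:E.
  move=> e0; pose t := (1 + e / (s ^+ 2 *+ 2))%R.
  have d0 : (0 < s ^+ 2 *+ 2)%R by rewrite pmulrn_lgt0// exprn_gt0.
  have t1 : (1 < t)%R by rewrite ltrDl divr_gt0.
  have := key _ t1; clear key; have tt : (0 < t)%R := lt_trans ltr01 t1.
  have k0 : (0 < 1 - t ^- 2)%R by rewrite subr_gt0 invf_lt1 ?exprn_gt0// exprn_egt1.
  have k0' : (0 < (1 - t ^- 2) / (s ^+ 2 *+ 2))%R by rewrite divr_gt0.
  move: E0; case: (E) => [E'| |]//= E0; last by rewrite gt0_muley ?lte_fin// leye_eq.
  rewrite -EFinM -EFinD !lee_fin => h.
  have {h} : ((1 - t ^- 2) / (s ^+ 2 *+ 2) * E' <= e / (s ^+ 2 *+ 2))%R.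
    by rewrite -(lerD2l 1%R).
  rewrite mulrAC ler_pM2r ?invr_gt0// mulrC -ler_pdivlMr// => /le_trans; apply.
  rewrite ler_pdivrMr//.
  set dd := (e / (s ^+ 2 *+ 2))%R.
  have eE : (e = s ^+ 2 * (2 * dd))%R by rewrite /dd; field; rewrite gt_eqF.
  rewrite [leLHS]eE [in leRHS]eE.
  have -> : forall w, ((s ^+ 2 + s ^+ 2 * (2 * dd)) * w = s ^+ 2 * ((1 + 2 * dd) * w))%R.
    by move=> w; ring.
  rewrite ler_wpM2l ?sqr_ge0//.
  rewrite -(ler_pM2r (exprn_gt0 2 tt)).
  have -> : ((1 + 2 * dd) * (1 - t ^- 2) * t ^+ 2 = (1 + 2 * dd) * (t ^+ 2 - 1))%R.
    by field; rewrite gt_eqF.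
  rewrite -subr_ge0 (_ : (_ - _ = dd ^+ 2)%R) ?sqr_ge0//.
  by rewrite /t -/dd; ring.
by apply/lee_addgt0Pr => e e0; rewrite -EFinD; exact: E2.
Qed.


End NormalProb.

(** * Numerical constants *)

Section Constants.
Context {R : realType}.

(** The degree 4 Taylor polynomials P of exp (- u) and Q of exp u satisfy P Q = 1 + u^6/72 + u^8/576
    >= 1, while Q <= exp u; so exp (- u) <= 1/Q <= P. *)
Lemma expRN_le_taylor4 (u : R) : 0 <= u ->
  expR (- u) <= 1 - u + u ^+ 2 / 2 - u ^+ 3 / 6 + u ^+ 4 / 24.
Proof.
move=> u0; set A := expR (- u).
have h : 1 + u + u ^+ 2 / 2 + u ^+ 3 / 6 + u ^+ 4 / 24 <= expR u.
  have nd : nondecreasing_seq (series (exp_coeff u)).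
    apply/nondecreasing_seqP => n; rewrite seriesSr/= lerDl.
    by rewrite /exp_coeff/= divr_ge0// exprn_ge0.
  have := nondecreasing_cvgn_le nd (@is_cvg_series_exp_coeff R u) 5.
  rewrite -/(expR u); apply: le_trans.
  rewrite /series/= !big_nat_recr//= big_nil /exp_coeff/=.
  by rewrite le_eqVlt; apply/orP; left; apply/eqP; rewrite !factS fact0; field.
set Q := (X in X <= _) in h; set P := (X in _ <= X).
have A0 : 0 < A by exact: expR_gt0.
have eA : expR u * A = 1 by exact: expRxMexpNx_1.
have PQ : 1 <= P * Q.
  have -> : P * Q = 1 + (u ^+ 3) ^+ 2 / 72 + (u ^+ 4) ^+ 2 / 576 by rewrite /P /Q; field.
  by rewrite -addrA lerDl addr_ge0 ?divr_ge0 ?sqr_ge0 ?ler0n.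
have Q0 : 0 < Q.
  by rewrite /Q; do 4 (rewrite ltr_wpDr ?divr_ge0 ?exprn_ge0//).
rewrite -(ler_pM2r Q0) (le_trans _ PQ)// -eA mulrC.
by rewrite ler_pM2r.
Qed.

(** Half the bound, 1.5696, is just below pi/2. Four terms of the cosine series already have a
    positive sum there, and the later terms pair up into positive amounts; a positive cosine rules
    out pi/2 < [x]. *)
Lemma pi_ge_1962_625 : 1962 / 625 <= pi :> R.
Proof.
pose x : R := 981 / 625.
have cosx : 0 < cos x.
  have h := @cvg_cos_coeff' R x; rewrite -(cvg_lim (@Rhausdorff R) h).
  apply: (@lt_trans _ _ (\sum_(0 <= i < 4) cos_coeff' x i)).
    rewrite !big_nat_recr//= big_nil add0r /cos_coeff'.
    rewrite -!exprnP /= !factS fact0 /x; lra.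
  apply: lt_sum_lim_series; [by move/cvgP in h|move=> d].
  rewrite addnS.
  have : ~~ odd (4 + d.*2)%N by rewrite oddD odd_double.
  have : (4 <= 4 + d.*2)%N by rewrite leq_addr.
  move: (4 + d.*2)%N => n n4 en.
  have s1 : (-1) ^ n%:Z = 1 :> R by rewrite -exprnP -signr_odd (negbTE en).
  have s2 : (-1) ^ n.+1%:Z = -1 :> R.
    by rewrite -exprnP -signr_odd/= en.
  rewrite /cos_coeff' s1 s2 mul1r mulN1r mulNr subr_gt0 doubleS.
  have : (0 < (n.*2)`!%:R :> R) by rewrite ltr0n fact_gt0.
  rewrite !factS !natrM; move: (n.*2)`!%:R => f f0.
  have n1 : 0 < n.*2.+1%:R :> R by rewrite ltr0n.
  have n2 : 8 <= n.*2.+2%:R :> R.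
    rewrite ler_nat -muln2; apply: leq_trans (leq_mul n4 (leqnn 2)) _.
    by rewrite ltnW// ltnS leqnSn.
  have n3 : 1 <= n.*2.+1%:R :> R by rewrite ler1n.
  have x0 : 0 < x by rewrite /x; lra.
  rewrite ltr_pdivrMr; last by rewrite !mulr_gt0// (lt_le_trans _ n2).
  rewrite -[n.*2.+2 in ltLHS]addn2 exprD.
  move: n1 n2 n3; move: n.*2.+2%:R n.*2.+1%:R => A B n1 n2 n3.
  rewrite (_ : x ^+ n.*2 / f * (A * (B * f)) = x ^+ n.*2 * (A * B)); last first.
    by field; rewrite gt_eqF.
  rewrite ltr_pM2l ?exprn_gt0//; apply: (@lt_le_trans _ _ (8 * 1)).
    by rewrite /x; lra.
  by rewrite ler_pM.
rewrite -/x; have xx : 1962 / 625 = x * 2 by rewrite /x; lra.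
rewrite xx -ler_pdivlMr// leNgt; apply/negP => ltx.
have pi2 := @pi_ge2 R.
have : cos x < cos (pi / 2).
  by rewrite ltr_cos// in_itv/=; apply/andP; split; rewrite /x; lra.
by rewrite cos_pihalf ltNge (ltW cosx).
Qed.

(* Integral from 0 to 3/4 of the Taylor polynomial of exp (- x ^ 2 / 2). *)
Definition tail_taylor : R :=
  3 / 4 - (3 / 4) ^+ 3 / 6 + (3 / 4) ^+ 5 / 40 - (3 / 4) ^+ 7 / 336 + (3 / 4) ^+ 9 / 3456.

(** A lower bound for P(|g| > 3/4) with g standard. For [s] > 0, [normal_peak s * s] is 1 / sqrt(2
    pi), so the value does not depend on [s]. *)
Definition tail_mass (s : R) : R := 1 - 2 * normal_peak s * s * tail_taylor.

(* Slightly less than 3/4, so that the test vector only needs to nearly realize a norm. *)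
Definition test_ratio : R := 749 / 999.

Lemma test_ratio_gt0 : 0 < test_ratio.
Proof. by rewrite /test_ratio; lra. Qed.

Lemma normal_peak_constant (s : R) : 0 < s ->
  2 * normal_peak s * s <= 235 / 100 * test_ratio * tail_mass s.
Proof.
move=> s0; rewrite /test_ratio /tail_mass; set k := 2 * normal_peak s * s.
have k0 : 0 <= k by rewrite !mulr_ge0 ?normal_peak_ge0// ltW.
have pi3 := pi_ge_1962_625; have p0 := @pi_gt0 R.
have k2 : k * k * pi = 2.
  rewrite -expr2 /k /normal_peak !exprMn exprVn sqr_sqrtr; last first.
    by rewrite mulrn_wge0// mulr_ge0 ?sqr_ge0 ?pi_ge0.
  by move: (pi : R) p0 => p p0; field; rewrite !gt_eqF.
(* [k] is sqrt(2/pi), about 0.79788, and the claim, linear in [k], holds up to about 0.7982. This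
   fixes the precision asked of the bound on pi. *)
have k1 : k <= 3991 / 5000.
  rewrite leNgt; apply/negP => kc; set c : R := 3991 / 5000 in kc.
  have c0 : 0 <= c by rewrite /c; lra.
  have cc : c * c < k * k := ltr_pM c0 c0 kc kc.
  have : c * c * (1962 / 625) <= 2.
    rewrite -k2; apply: ler_pM (mulr_ge0 c0 c0) _ (ltW cc) pi3.
    by rewrite divr_ge0 ?ler0n.
  by rewrite /c; lra.
by rewrite /tail_taylor; lra.
Qed.

Lemma tail_mass_gt0 (s : R) : 0 < s -> 0 < tail_mass s.
Proof.
move=> s0; have k1 : 0 < 235 / 100 * test_ratio by have := test_ratio_gt0; lra.
rewrite -(pmulr_rgt0 _ k1); apply: lt_le_trans (normal_peak_constant s0).
by rewrite !mulr_gt0 ?normal_peak_gt0// gt_eqF.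
Qed.

End Constants.

(** * The normal tail beyond 3/4 of a standard deviation *)

Section NormalTail.
Context {R : realType}.
Notation leb := (@lebesgue_measure R).

Lemma integral_deriv_poly (p : {poly R}) (a b : R) : a < b ->
  (\int[leb]_(x in `[a, b]) (p^`().[x])%:E = (p.[b] - p.[a])%:E)%E.
Proof.
move=> ab; rewrite (continuous_FTC2 (F := horner p)) ?EFinB//.
- by apply: continuous_subspaceT => x; exact: continuous_horner.
- split.
  + by move=> x _; exact: derivable_horner.
  + by apply: cvg_at_right_filter; exact: continuous_horner.
  + by apply: cvg_at_left_filter; exact: continuous_horner.
- by move=> x _; rewrite -derivE.
Qed.

Variable s : R.
Hypothesis s0 : 0 < s.
Notation gam := (normal_prob (0 : R) s).

Lemma normal_prob_center :
  (gam `[(- (3 / 4 * s))%R, (3 / 4 * s)%R]%classic <=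
   (2 * normal_peak s * s * tail_taylor)%R%:E)%E.
Proof.
have b0 : 0 < 3 / 4 * s by rewrite mulr_gt0.
(* An odd antiderivative of the Taylor upper bound of the density, with u = x^2 / (2 s^2) in
   [expRN_le_taylor4]. *)
pose p : {poly R} := normal_peak s *: ('X - (s ^- 2 / 6) *: 'X^3 + (s ^- 4 / 40) *: 'X^5
  - (s ^- 6 / 336) *: 'X^7 + (s ^- 8 / 3456) *: 'X^9).
have -> : 2 * normal_peak s * s * tail_taylor = p.[3 / 4 * s] - p.[- (3 / 4 * s)].
  have pE x : p.[x] = normal_peak s * (x - s ^- 2 / 6 * x ^+ 3 + s ^- 4 / 40 * x ^+ 5
      - s ^- 6 / 336 * x ^+ 7 + s ^- 8 / 3456 * x ^+ 9).
    by rewrite /p !(hornerD, hornerN, hornerZ, hornerXn, hornerX).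
  rewrite !pE /tail_taylor; move: (normal_peak s) (3 / 4) => k b; field.
  by rewrite gt_eqF.
rewrite -integral_deriv_poly; last by rewrite gtrN.
apply: ge0_le_integral => //=.
- by move=> x _; rewrite lee_fin normal_pdf_ge0.
- by apply/measurable_EFinP/measurable_funTS; exact: measurable_normal_pdf.
- apply/measurable_EFinP/measurable_funTS.
  by apply: continuous_measurable_fun; exact: continuous_horner.
move=> x _; rewrite lee_fin normal_pdf0E//.
have u0 : 0 <= x ^+ 2 / (s ^+ 2 *+ 2) by rewrite divr_ge0 ?mulrn_wge0 ?sqr_ge0.
rewrite /p derivZ hornerZ ler_wpM2l ?normal_peak_ge0//.
apply: (le_trans (expRN_le_taylor4 u0)).
rewrite !(derivD, derivN, derivB, derivZ, derivXn, derivX) !hornerE/=.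
by rewrite le_eqVlt; apply/orP; left; apply/eqP; field; rewrite gt_eqF.
Qed.

Lemma normal_prob_tail (B : set R) : measurable B ->
  `]-oo, - (3 / 4 * s)[ `|` `]3 / 4 * s, +oo[ `<=` B ->
  ((tail_mass s)%:E <= gam B)%E.
Proof.
move=> mB sB.
apply: (@le_trans _ _ (gam (~` `[(- (3 / 4 * s))%R, (3 / 4 * s)%R]%classic)))%E.
  rewrite probability_setC// /tail_mass EFinB leeD2l// leeN2.
  exact: normal_prob_center.
apply: le_measure; rewrite ?inE//; first exact: measurableC.
apply: subset_trans sB => x /= /negP; rewrite in_itv/= negb_and -!ltNge.
by move=> /orP[?|?]; [left|right]; rewrite /= in_itv/= ?andbT.
Qed.

End NormalTail.

(** * Euclidean norms and Moore-Penrose inverses *)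

Section Euclidean.
Context {R : realType}.

Definition dot n (u v : 'cV[R]_n) : R := (u^T *m v) 0 0.

Lemma dotE n (u v : 'cV[R]_n) : dot u v = \sum_i u i 0 * v i 0.
Proof. by rewrite /dot mxE; apply: eq_bigr => i _; rewrite mxE. Qed.

Lemma dotC n (u v : 'cV[R]_n) : dot u v = dot v u.
Proof. by rewrite !dotE; apply: eq_bigr => i _; rewrite mulrC. Qed.

Lemma dotM m n (A : 'M[R]_(m, n)) u v : dot u (A *m v) = dot (A^T *m u) v.
Proof. by rewrite /dot trmx_mul trmxK mulmxA. Qed.

Lemma dotZr n a (u v : 'cV[R]_n) : dot u (a *: v) = a * dot u v.
Proof. by rewrite /dot -scalemxAr mxE. Qed.

Lemma dotZl n a (u v : 'cV[R]_n) : dot (a *: u) v = a * dot u v.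
Proof. by rewrite dotC dotZr dotC. Qed.

Lemma dotBr n (u v w : 'cV[R]_n) : dot u (v - w) = dot u v - dot u w.
Proof. by rewrite /dot mulmxBr !mxE. Qed.

Lemma dotBl n (u v w : 'cV[R]_n) : dot (v - w) u = dot v u - dot w u.
Proof. by rewrite dotC dotBr dotC (dotC u). Qed.

Lemma l2norm_sqr n (u : 'cV[R]_n) : l2norm u ^+ 2 = dot u u.
Proof.
rewrite dotE sqr_sqrtr; last by apply: sumr_ge0 => i _; exact: sqr_ge0.
by apply: eq_bigr => i _; rewrite expr2.
Qed.

(** Cauchy-Schwarz, by expanding the squared norm of |v|^2 u - <u, v> v. *)
Lemma dot_le n (u v : 'cV[R]_n) : `|dot u v| <= l2norm u * l2norm v.
Proof.
have [v0|v0] := eqVneq (l2norm v) 0.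
  by rewrite (l2norm_eq0 v0) /dot mulmx0 mxE normr0 l2norm0 mulr0.
rewrite -[leRHS]ger0_norm ?mulr_ge0 ?l2norm_ge0// -ler_sqr ?nnegrE//.
rewrite !real_normK ?num_real// exprMn.
have vv : 0 < l2norm v ^+ 2 by rewrite exprn_gt0// lt_def v0 l2norm_ge0.
have := sqr_ge0 (l2norm (l2norm v ^+ 2 *: u - dot u v *: v)).
rewrite (l2norm_sqr (_ - _)) !(dotBr, dotBl, dotZr, dotZl) (dotC v u) -!l2norm_sqr.
set a := l2norm u; set b := l2norm v in vv *; set c := dot u v.
rewrite (_ : _ - _ = b ^+ 2 * (a ^+ 2 * b ^+ 2 - c ^+ 2)); last by ring.
by rewrite pmulr_rge0// subr_ge0.
Qed.

Lemma le_l2norm_dot n (u : 'cV[R]_n) c : 0 <= c ->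
  dot u u <= l2norm u * c -> l2norm u <= c.
Proof.
move=> c0; rewrite -l2norm_sqr expr2.
have [->//|u0] := eqVneq (l2norm u) 0.
by rewrite ler_pM2l// lt_def u0 l2norm_ge0.
Qed.

Lemma spectral_norm_ge0 m n (A : 'M[R]_(m, n)) : 0 <= spectral_norm A.
Proof.
apply: (ub_le_sup (has_sup_spectral_norm A).2).
by exists 0; rewrite /= ?mulmx0 l2norm0.
Qed.

Lemma spectral_norm_le m n (A : 'M[R]_(m, n)) c :
  (forall v, l2norm v <= 1 -> l2norm (A *m v) <= c) -> spectral_norm A <= c.
Proof.
move=> Ac; apply: sup_le_ub; first exact: (has_sup_spectral_norm A).1.
by move=> _ [v /= v1 <-]; exact: Ac.
Qed.

Lemma l2norm_mulmx_le m n (A : 'M[R]_(m, n)) v :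
  l2norm (A *m v) <= spectral_norm A * l2norm v.
Proof.
have [v0|v0] := eqVneq (l2norm v) 0.
  by rewrite (l2norm_eq0 v0) mulmx0 !l2norm0 mulr0.
have vv : 0 < l2norm v by rewrite lt_def v0 l2norm_ge0.
rewrite -ler_pdivrMr//.
apply: (ub_le_sup (has_sup_spectral_norm A).2); exists ((l2norm v)^-1 *: v).
  by rewrite /= l2normZ ger0_norm ?invr_ge0 ?l2norm_ge0// mulVf.
by rewrite -scalemxAr l2normZ ger0_norm ?invr_ge0 ?l2norm_ge0// mulrC.
Qed.

Lemma spectral_norm_gt_ex m n (A : 'M[R]_(m, n)) c : c < spectral_norm A ->
  exists2 v, l2norm v <= 1 & c < l2norm (A *m v).
Proof.
move=> /(sup_gt (has_sup_spectral_norm A).1)[_ [v /= v1 <-] cv].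
by exists v.
Qed.

Lemma spectral_normM m n k (A : 'M[R]_(m, n)) (B : 'M[R]_(n, k)) :
  spectral_norm (A *m B) <= spectral_norm A * spectral_norm B.
Proof.
apply: spectral_norm_le => v v1; rewrite -mulmxA.
rewrite (le_trans (l2norm_mulmx_le _ _))// ler_wpM2l ?spectral_norm_ge0//.
rewrite (le_trans (l2norm_mulmx_le _ _))// ler_piMr ?spectral_norm_ge0//.
Qed.

Lemma spectral_norm_tr_le m n (A : 'M[R]_(m, n)) :
  spectral_norm A <= spectral_norm A^T.
Proof.
apply: spectral_norm_le => v v1; apply: le_l2norm_dot; first exact: spectral_norm_ge0.
rewrite dotM (le_trans (ler_norm _))// (le_trans (dot_le _ _))//.
rewrite (le_trans (ler_wpM2l (l2norm_ge0 _) v1))// mulr1.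
by rewrite mulrC l2norm_mulmx_le.
Qed.

Lemma spectral_norm_tr m n (A : 'M[R]_(m, n)) : spectral_norm A^T = spectral_norm A.
Proof.
have := spectral_norm_tr_le A^T; rewrite trmxK => h.
by apply/eqP; rewrite eq_le h spectral_norm_tr_le.
Qed.

Lemma spectral_norm_eq0 m n (A : 'M[R]_(m, n)) : spectral_norm A = 0 -> A = 0.
Proof.
move=> A0; apply/matrixP => i j; rewrite mxE.
have /l2norm_eq0 : l2norm (A *m delta_mx j 0) = 0.
  apply/eqP; rewrite eq_le l2norm_ge0 andbT.
  by rewrite (le_trans (l2norm_mulmx_le _ _))// A0 mul0r.
by rewrite -colE => /colP/(_ i); rewrite !mxE.
Qed.

Lemma moore_penrose_tr m n (A : 'M[R]_(m, n)) : moore_penrose A^T = (moore_penrose A)^T.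
Proof.
apply: moore_penrose_eq; have [e1 e2 e3 e4] := moore_penroseP A; split.
- by rewrite -!trmx_mul mulmxA e1.
- by rewrite -!trmx_mul mulmxA e2.
- by rewrite -trmx_mul e4.
- by rewrite -trmx_mul e3.
Qed.

Lemma moore_penrose_eq0 m n (A : 'M[R]_(m, n)) : moore_penrose A = 0 -> A = 0.
Proof. by move=> A0; have [<- _ _ _] := moore_penroseP A; rewrite A0 mulmx0 mul0mx. Qed.

Lemma l2norm_projection n (Q : 'M[R]_n) v : Q^T = Q -> Q *m Q = Q ->
  l2norm (Q *m v) <= l2norm v.
Proof.
move=> sQ QQ; apply: le_l2norm_dot; first exact: l2norm_ge0.
by rewrite dotM sQ mulmxA QQ (le_trans (ler_norm _))// dot_le.
Qed.

(** The matrix A^+ A is an orthogonal projection, so A^+ selects the shortest solution of a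
    consistent system. Exhibiting any solution [z] therefore bounds the image of the right-hand side
    under A^+. *)
Lemma moore_penrose_solution m n (A : 'M[R]_(m, n)) z :
  l2norm (moore_penrose A *m (A *m z)) <= l2norm z.
Proof.
have [e1 e2 e3 e4] := moore_penroseP A.
by rewrite mulmxA l2norm_projection// -!mulmxA (mulmxA _ _ A) e1.
Qed.

(** With X = (MH)^+, X = X (MHX)^T shows that the rows of X come from the range of M, which the
    projection M M^+ fixes. *)
Lemma moore_penrose_mulmxl m n k (M : 'M[R]_(m, n)) (H : 'M[R]_(n, k)) :
  moore_penrose (M *m H) *m M *m moore_penrose M = moore_penrose (M *m H).
Proof.
have [e1 e2 e3 e4] := moore_penroseP (M *m H).
have [f1 f2 f3 f4] := moore_penroseP M.
set X := moore_penrose (M *m H) in e1 e2 e3 e4 *.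
have XE : X = X *m (M *m H *m X)^T by rewrite e3 mulmxA e2.
rewrite {1}XE [RHS]XE -!mulmxA; congr (X *m _).
by rewrite -f3 -trmx_mul !mulmxA f1.
Qed.

Lemma mxtrace_projection l a (L : 'M[R]_(l, a)) :
  \tr (moore_penrose L *m L) = (\rank L)%:R.
Proof.
have [e1 _ _ _] := moore_penroseP L.
rewrite -{2}(mulmx_base L) mulmxA mxtrace_mulC.
(* For the full rank factorization L = C B, the equation L L^+ L = L reads C (B L^+ C) B = C B, and
   both outer factors cancel. *)
suff -> : row_base L *m (moore_penrose L *m col_base L) = 1%:M by rewrite mxtrace1.
have rf := row_base_free L; have cf := col_base_full L.
move: (col_base L) (row_base L) (mulmx_base L) rf cf => C B CB rf cf.
apply: (row_free_inj rf); apply: (row_full_inj cf).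
by rewrite /= mul1mx !mulmxA CB -mulmxA CB e1.
Qed.

End Euclidean.

(** * The deterministic estimate for the image of a fixed vector *)

Section Deterministic.
Context {R : realType}.
Variables (l a b n : nat) (L : 'M[R]_(l, a.+1)) (N : 'M[R]_(b, n)).
Hypothesis rLN : (\rank L <= \rank N)%N.
Variables (p : 'cV[R]_a.+1) (Q : 'M[R]_a.+1) (c : R).
Let Pi := moore_penrose L *m L.
Let p' := Pi *m p.
Hypotheses (p'0 : p' != 0) (QQ : Q^T *m Q = 1%:M) (Qp' : Q *m p' = c *: delta_mx 0 0).

Let PiPi : Pi *m Pi = Pi.
Proof. by have [e1 e2 _ _] := moore_penroseP L; rewrite /Pi mulmxA e2. Qed.

Let PiT : Pi^T = Pi.
Proof. by have [] := moore_penroseP L. Qed.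

Let LPi : L *m Pi = L.
Proof. by have [e1 _ _ _] := moore_penroseP L; rewrite /Pi mulmxA e1. Qed.

Let Pip' : Pi *m p' = p'.
Proof. by rewrite /p' mulmxA PiPi. Qed.

Let p'E : p' = c *: (Q^T *m delta_mx 0 0).
Proof. by rewrite scalemxAr -Qp' mulmxA QQ mul1mx. Qed.

Let c2 : c ^+ 2 = dot p' p'.
Proof.
have -> : dot p' p' = dot (Q *m p') (Q *m p') by rewrite [RHS]dotM mulmxA QQ mul1mx.
rewrite Qp' dotZl dotZr dotE (bigD1 ord0)//= big1 => [|i i0].
  by rewrite !mxE !eqxx/= addr0 !mulr1 expr2.
by rewrite !mxE (negbTE i0) mul0r.
Qed.

Let c0 : c != 0.
Proof. by apply: contraNneq p'0 => h; rewrite p'E h scale0r. Qed.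

(** The orthogonal projection onto the part of the row space of [L] orthogonal to [p'], since |p'|^2
    = [c ^+ 2]. *)
Let Pi' := Pi - c ^- 2 *: (p' *m p'^T).

Let p'p' : p'^T *m p' = (c ^+ 2)%:M.
Proof. by rewrite c2 /dot [LHS]mx11_scalar. Qed.

Let Pi'p' : Pi' *m p' = 0.
Proof.
rewrite mulmxBl Pip' -scalemxAl -mulmxA p'p' mul_mx_scalar scalerA.
by rewrite mulVf ?scale1r ?subrr// expf_neq0.
Qed.

Let rank_Pi' : (\rank Pi' < \rank L)%N.
Proof.
have sub : (Pi' <= Pi)%MS.
  rewrite (_ : Pi' = Pi' *m Pi) ?submxMl//.
  have p'Pi : p'^T *m Pi = p'^T by rewrite -[X in _ *m X]PiT -trmx_mul Pip'.
  by rewrite mulmxBl PiPi -scalemxAl -mulmxA p'Pi.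
have lt : (Pi' < Pi)%MS.
  rewrite ltmxE sub /=; apply/negP => sub'.
  have /submxP[D p'D] : (p'^T <= Pi')%MS.
    by apply: submx_trans sub'; rewrite -Pip' trmx_mul PiT submxMl.
  have : p'^T *m p' = 0 by rewrite p'D -mulmxA Pi'p' mulmx0.
  rewrite p'p' => /matrixP/(_ 0 0); rewrite !mxE eqxx mulr1n => /eqP.
  by rewrite expf_eq0/= (negbTE c0).
by rewrite (leq_trans (rank_ltmx lt))// mxrankM_maxr.
Qed.

(** Dimension count: [W] has rank at most that of [Pi'], which is below rank L <= rank N, so the
    kernel of [W] meets the range of [N] nontrivially. The intersection is formed with transposes
    because subspaces are row spaces. *)
Lemma exists_normal_vector (B : 'M[R]_(a.+1, b)) :
  exists q : 'cV[R]_b, [/\ l2norm q = 1, exists y, q = N *m y &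
    Pi' *m Q^T *m B *m q = 0].
Proof.
set W := Pi' *m Q^T *m B.
have rW : (\rank W < \rank N)%N.
  rewrite (leq_trans _ rLN)// (leq_ltn_trans _ rank_Pi')//.
  by rewrite /W -mulmxA mxrankM_maxl.
have : (N^T :&: kermx W^T)%MS != 0.
  rewrite -mxrank_eq0 -lt0n; have := mxrank_mul_ker N^T W^T.
  have : (\rank (N^T *m W^T) < \rank N)%N.
    by rewrite -trmx_mul mxrank_tr (leq_ltn_trans _ rW)// mxrankM_maxl.
  move=> h; rewrite (mxrank_tr N) => E; rewrite -E in h.
  by move: h; rewrite -[X in (X < _)%N]addn0 ltn_add2l.
rewrite -nz_row_eq0; set v := nz_row _ => v0.
have : (v <= N^T :&: kermx W^T)%MS by exact: nz_row_sub.
rewrite sub_capmx => /andP[/submxP[D vD] /sub_kermxP vW].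
have vT0 : l2norm v^T != 0.
  apply: contraNneq v0 => /l2norm_eq0 /(congr1 trmx).
  by rewrite trmxK trmx0 => ->.
exists ((l2norm v^T)^-1 *: v^T); split.
- by rewrite l2normZ ger0_norm ?invr_ge0 ?l2norm_ge0// mulVf.
- by exists ((l2norm v^T)^-1 *: D^T); rewrite vD trmx_mul trmxK scalemxAr.
- rewrite -scalemxAr -/W; have -> : W *m v^T = (v *m W^T)^T by rewrite trmx_mul trmxK.
  by rewrite vW trmx0 scaler0.
Qed.

(** The first column of [Q^T] is proportional to [p'], which [Pi'] kills. So the condition imposed
    on q does not see row 0, and q can be chosen before that row is drawn. *)
Lemma normal_vector_row0 (B1 B2 : 'M[R]_(a.+1, b)) :
  (forall i j, i != 0 -> B1 i j = B2 i j) -> Pi' *m Q^T *m B1 = Pi' *m Q^T *m B2.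
Proof.
move=> B12; have col0 : Pi' *m Q^T *m delta_mx 0 0 = 0 :> 'cV_a.+1.
  apply: (scalerI c0); rewrite scaler0 -mulmxA scalemxAr -p'E.
  exact: Pi'p'.
apply/matrixP => i j; rewrite !mxE; apply: eq_bigr => k _.
have [->|k0] := eqVneq k 0; last by rewrite B12.
by move: col0; rewrite -colE => /colP/(_ i); rewrite !mxE => ->; rewrite !mul0r.
Qed.

(** The vector Q^T B q has no component along [Pi'], so its projection on the row space of [L] is
    (g/c) p'. A multiple of N^+ q thus solves the system with right-hand side L p' = L p, and the
    pseudo-inverse solution is no longer than it. *)
Lemma pinv_image_bound (B : 'M[R]_(a.+1, b)) (q : 'cV[R]_b) :
  l2norm q = 1 -> (exists y, q = N *m y) -> Pi' *m Q^T *m B *m q = 0 ->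
  l2norm (moore_penrose (L *m (Q^T *m B) *m N) *m (L *m p)) * `|(B *m q) 0 0|
    <= spectral_norm (moore_penrose N) * l2norm p'.
Proof.
move=> q1 [y qy] Bq; set X := moore_penrose _.
set g := (B *m q) 0 0.
have [->|g0] := eqVneq g 0.
  by rewrite normr0 mulr0 mulr_ge0 ?spectral_norm_ge0 ?l2norm_ge0.
pose z := (c / g) *: (moore_penrose N *m q).
have NNq : N *m (moore_penrose N *m q) = q.
  by have [f1 _ _ _] := moore_penroseP N; rewrite qy !mulmxA f1.
have PiBq : Pi *m (Q^T *m B *m q) = (g / c) *: p'.
  have : Pi' *m (Q^T *m B *m q) = 0 by rewrite !mulmxA.
  rewrite mulmxBl => /subr0_eq ->.
  rewrite -scalemxAl.
  have -> : p' *m p'^T *m (Q^T *m B *m q) = p' *m (p'^T *m (Q^T *m (B *m q))).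
    by rewrite !mulmxA.
  have -> : p'^T *m (Q^T *m (B *m q)) = (c * g)%:M.
    rewrite mulmxA -trmx_mul Qp' [LHS]mx11_scalar linearZ/= -scalemxAl mxE.
    rewrite trmx_delta -rowE mxE.
    by [].
  rewrite mul_mx_scalar scalerA; congr (_ *: _); field.
  by [].
have Lz : L *m (Q^T *m B) *m N *m z = L *m p.
  rewrite /z -scalemxAr -!(mulmxA _ N) -!(mulmxA L) NNq.
  have -> : L *m (Q^T *m B *m q) = L *m (Pi *m (Q^T *m B *m q)).
    by rewrite (mulmxA L Pi) LPi.
  rewrite PiBq -scalemxAr scalerA (mulmxA L) LPi.
  by rewrite (_ : c / g * (g / c) = 1) ?scale1r//; field; rewrite c0 g0.
rewrite -Lz -ler_pdivlMr ?normr_gt0//.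
apply: le_trans (moore_penrose_solution _ _) _.
rewrite /z l2normZ normrM normfV mulrAC ler_pM2r ?invr_gt0 ?normr_gt0//.
have -> : l2norm p' = `|c|.
  by rewrite -(ger0_norm (l2norm_ge0 p')) -!sqrtr_sqr l2norm_sqr -c2.
rewrite mulrC ler_pM2r ?normr_gt0//.
by rewrite (le_trans (l2norm_mulmx_le _ _))// q1 mulr1.
Qed.

End Deterministic.

(** * Families of independent normal variables *)

Section Families.
Context {R : realType} {I : finType}.

(** A family closed under intersection that generates the product sigma-algebra on [I -> R], so that
    it determines probability laws there. *)
Definition boxes : set (set (I -> R)) :=
  [set [set x | forall i, B i (x i)] | B in [set B | forall i, measurable (B i)]].

Notation vec := (g_sigma_algebraType boxes).

Lemma measurable_box (B : I -> set R) : (forall i, measurable (B i)) ->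
  measurable ([set x | forall i, B i (x i)] : set vec).
Proof. by move=> mB; apply: sub_sigma_algebra; exists B. Qed.

Lemma measurable_coord i : measurable_fun [set: vec] (fun x : vec => x i).
Proof.
move=> _ B mB; rewrite setTI.
rewrite (_ : _ @^-1` B = [set x | forall j, (if j == i then B else setT) (x j)]).
  by apply: (measurable_box (B := fun j => if j == i then B else setT)) => j; case: ifP.
apply/seteqP; split => x /= => [Bx j|/(_ i)]; last by rewrite eqxx.
by case: eqP => [->|].
Qed.

Lemma measurable_to_vec d (T : measurableType d) (X : I -> T -> R) :
  (forall i, measurable_fun [set: T] (X i)) ->
  measurable_fun [set: T] (fun w => X^~ w : vec).
Proof.
move=> mX; apply: (@measurability _ _ T vec setT _ boxes) => //.
move=> _ [_ [B mB <-] <-]; rewrite setTI.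
rewrite (_ : _ @^-1` _ = \bigcap_(i in [set: I]) (X i @^-1` B i)).
  apply: fin_bigcap_measurable => // i _; rewrite -[X in measurable X]setTI.
  exact: mX.
by apply/seteqP; split => w /= Bw i; [move=> _|]; exact: Bw.
Qed.

(** Independence and the centred marginals in one formula; taking some [B i] to be the full line
    gives every subfamily. *)
Definition iid_normal (s : R) d (T : measurableType d) (P : probability T R)
    (X : I -> T -> R) : Prop :=
  (forall i, measurable_fun [set: T] (X i)) /\
  forall B : I -> set R, (forall i, measurable (B i)) ->
    P [set w | forall i, B i (X i w)] = (\prod_i normal_prob (0 : R) s (B i))%E.

(** Two laws agreeing on boxes are equal. The sample spaces may differ, which allows coordinates to
    be replaced by independent copies on a product space. *)
Lemma iid_normal_law s d (T : measurableType d) (P : probability T R)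
    d' (T' : measurableType d') (P' : probability T' R)
    (X : I -> T -> R) (X' : I -> T' -> R) (A : set (I -> R)) :
  iid_normal s P X -> iid_normal s P' X' -> measurable (A : set vec) ->
  P [set w | A (X^~ w)] = P' [set w | A (X'^~ w)].
Proof.
move=> [mX PX] [mX' PX'] mA.
pose f : {RV P >-> vec} := mfun_Sub (mem_set (measurable_to_vec mX)).
pose f' : {RV P' >-> vec} := mfun_Sub (mem_set (measurable_to_vec mX')).
suff : distribution P f A = distribution P' f' A by [].
apply: (@measure_unique _ _ vec boxes (fun=> setT) _ _ _ _
  (distribution P f) (distribution P' f')) => //.
- move=> _ _ [B mB <-] [B' mB' <-]; exists (fun i => B i `&` B' i).
    by move=> i; exact: measurableI.
  apply/seteqP; split => x /=; last by move=> [h h'] i; split.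
  by move=> h; split => i; case: (h i).
- by move=> _; exists (fun=> setT) => //; apply/seteqP; split.
- by apply/seteqP; split => // x _; exists 0%N.
- by move=> _ [B mB <-]; rewrite [LHS]PX// [RHS]PX'.
- by move=> _; rewrite (le_lt_trans (probability_le1 _ _)) ?ltry.
Qed.

Lemma iid_normal_partial s d (T : measurableType d) (P : probability T R)
    (X : I -> T -> R) (D : pred I) (B : I -> set R) :
  iid_normal s P X -> (forall i, measurable (B i)) ->
  P [set w | forall i, D i -> B i (X i w)] =
  (\prod_(i | D i) normal_prob (0 : R) s (B i))%E.
Proof.
move=> [mX PX] mB; pose B' i := if D i then B i else setT.
rewrite (_ : [set w | _] = [set w | forall i, B' i (X i w)]); last first.
  apply/seteqP; split => w /= h i; first by rewrite /B'; case: ifPn => // /h.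
  by move=> Di; have := h i; rewrite /B' Di.
rewrite PX => [|i]; last by rewrite /B'; case: ifP.
rewrite [RHS]big_mkcond/=; apply: eq_bigr => i _; rewrite /B'.
by case: ifP => // _; exact: probability_setT.
Qed.

Variables (k l : I) (s : R).
Hypotheses (kl : k != l) (s0 : 0 < s).
Notation gam := (normal_prob (0 : R) s).

(** A rotated rectangle is no longer a box, so the product formula is needed for an arbitrary plane
    set [E] in the coordinates [k] and [l]. *)
Lemma iid_normal_pair d (T : measurableType d) (P : probability T R)
    (X : I -> T -> R) (B : I -> set R) (E : set (R * R)) :
  iid_normal s P X -> (forall i, measurable (B i)) -> measurable E ->
  P [set w | (forall i, (i != k) && (i != l) -> B i (X i w)) /\ E (X k w, X l w)] =
  (\prod_(i | (i != k) && (i != l)) gam (B i) * (gam \x gam) E)%E.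
Proof.
move=> iX mB mE; have [mX PX] := iX.
pose gg : probability (measurableTypeR R * measurableTypeR R)%type R :=
  (gam \x gam)%E.
(* Coordinates [k] and [l] are drawn afresh from the plane. The law is unchanged, and the event
   becomes a product set. *)
pose X' (i : I) (z : T * (R * R)) : R :=
  if i == k then z.2.1 else if i == l then z.2.2 else X i z.1.
have mC (B' : I -> set R) : (forall i, measurable (B' i)) ->
    measurable [set w | forall i, (i != k) && (i != l) -> B' i (X i w)].
  move=> mB'; rewrite (_ : [set w | _] =
    \bigcap_(i in [set i | (i != k) && (i != l)]) (X i @^-1` B' i)).
    apply: fin_bigcap_measurable => [|i _]; first exact: finite_finset.
    by rewrite -[X in measurable X]setTI; exact: mX.
  by apply/seteqP; split => w h i; exact: h.
have X'E (B' : I -> set R) (E' : set (R * R)) : (forall i, measurable (B' i)) -> measurable E' ->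
    (P \x gg)%E [set z | (forall i, (i != k) && (i != l) -> B' i (X' i z)) /\
      E' (X' k z, X' l z)] =
    (\prod_(i | (i != k) && (i != l)) gam (B' i) * gg E')%E.
  move=> mB' mE'.
  have -> : [set z | (forall i, (i != k) && (i != l) -> B' i (X' i z)) /\
      E' (X' k z, X' l z)] =
    [set w | forall i, (i != k) && (i != l) -> B' i (X i w)] `*` E'.
    rewrite /X' eqxx eq_sym (negbTE kl) eqxx; apply/seteqP; split => -[w [x y]] /= [h ?].
      by split => // i ikl; have := h i ikl; case/andP: ikl => /negbTE -> /negbTE ->.
    by split => // i ikl; have := h i ikl; case/andP: ikl => /negbTE -> /negbTE ->.
  rewrite -(iid_normal_partial _ iX mB').
  exact: (@product_measure1E _ _ _ _ _ P gg _ _ (mC _ mB') mE').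
have iX' : iid_normal s (P \x gg)%E X'.
  split.
    move=> i; rewrite /X'; case: (i == k); last case: (i == l).
    - by apply: measurableT_comp => //; exact: measurableT_comp.
    - by apply: measurableT_comp => //; exact: measurableT_comp.
    - by apply: measurableT_comp.
  move=> B' mB'; rewrite (bigD1 k)//= (bigD1 l)//= 1?eq_sym//.
  rewrite muleA muleC.
  have <- : gg (B' k `*` B' l) = (gam (B' k) * gam (B' l))%E.
    by apply: product_measure1E; exact: mB'.
  rewrite -(X'E _ _ mB' (measurableX (mB' k) (mB' l))).
  congr (product_measure1 _ _ _); apply/seteqP; split => z /= h.
    by split => [i _|]; [exact: h|split; exact: h].
  case: h => h [hk hl] i; have [->//|ik] := eqVneq i k.
  by have [->//|il] := eqVneq i l; apply: h; rewrite ik.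
rewrite -[X in (_ * X)%E]/(gg E) -(X'E _ _ mB mE).
pose A := [set x : I -> R | (forall i, (i != k) && (i != l) -> B i (x i)) /\ E (x k, x l)].
apply: (iid_normal_law (A := A) iX iX').
rewrite (_ : A = [set x | forall i, (if (i != k) && (i != l) then B i else setT) (x i)] `&`
  (fun x : vec => (x k, x l)) @^-1` E).
  apply: measurableI.
    by apply: (measurable_box (B := fun i => if (i != k) && (i != l) then B i else setT)) => i; case: ifP.
  have mkl : measurable_fun [set: vec] (fun x : vec => (x k, x l)).
    by apply/measurable_fun_pairP; split; exact: measurable_coord.
  by rewrite -[X in measurable X]setTI; exact: mkl.
apply/seteqP; split => x /= [h ?]; split => // i.
  by case: ifPn => // /h.
by move=> ikl; have := h i; rewrite ikl.
Qed.

Definition rotate_family (al be : R) T (X : I -> T -> R) (i : I) (w : T) : R :=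
  if i == k then al * X k w - be * X l w
  else if i == l then be * X k w + al * X l w else X i w.

Lemma iid_normal_rotate al be d (T : measurableType d) (P : probability T R)
    (X : I -> T -> R) : al ^+ 2 + be ^+ 2 = 1 -> al != - 1 ->
  iid_normal s P X -> iid_normal s P (rotate_family al be X).
Proof.
move=> ab1 alN1 iX; have [mX PX] := iX; split.
  move=> i; rewrite /rotate_family; case: (i == k); last case: (i == l) => //.
    by apply: measurable_funB; apply: measurable_funM.
  by apply: measurable_funD; apply: measurable_funM.
move=> B mB; rewrite (bigD1 k)//= (bigD1 l)//= 1?eq_sym//.
rewrite muleA muleC -(normal_prob_rotation s0 ab1 alN1)//.
have mr : measurable (rotation al be @^-1` (B k `*` B l)).
  rewrite -[X in measurable X]setTI; apply: measurable_rotation => //.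
  exact: measurableX.
rewrite -(iid_normal_pair iX mB mr); congr (P _).
rewrite /rotate_family; apply/seteqP; split => w /=.
  move=> h; split => [i|].
    by move=> /andP[ik il]; have := h i; rewrite (negbTE ik) (negbTE il).
  split; first by have := h k; rewrite eqxx.
  by have := h l; rewrite eq_sym (negbTE kl) eqxx.
move=> [h [hk hl]] i; case: eqP => [->//|/eqP ik].
by case: eqP => [->//|/eqP il]; apply: h; rewrite ik.
Qed.

End Families.

(** * Gaussian arrays under products of plane rotations *)

Section Givens.
Context {R : realType}.
Variable s : R.
Hypothesis s0 : 0 < s.

Definition mx_at a b T (Z : 'I_a * 'I_b -> T -> R) (w : T) : 'M[R]_(a, b) :=
  \matrix_(i, j) Z (i, j) w.

Definition mul_family a b T (Q : 'M[R]_a) (Z : 'I_a * 'I_b -> T -> R)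
  (ij : 'I_a * 'I_b) (w : T) : R := (Q *m mx_at Z w) ij.1 ij.2.

Lemma mx_at_mul_family a b T (Q : 'M[R]_a) (Z : 'I_a * 'I_b -> T -> R) w :
  mx_at (mul_family Q Z) w = Q *m mx_at Z w.
Proof. by apply/matrixP => i j; rewrite mxE. Qed.

(** Carried as a property of the particular [Q] that gets built. Quantifying over sample spaces and
    column counts makes it stable under products and usable for both vectors and matrices. *)
Definition preserves_iid a (Q : 'M[R]_a) : Prop :=
  forall b d (T : measurableType d) (P : probability T R) (Z : 'I_a * 'I_b -> T -> R),
    iid_normal s P Z -> iid_normal s P (mul_family Q Z).

Definition givens a (k l : 'I_a) (al be : R) : 'M[R]_a :=
  1%:M + (al - 1) *: (delta_mx k k + delta_mx l l)
  + be *: (delta_mx l k - delta_mx k l).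

Lemma givensE a b (k l : 'I_a) (al be : R) (A : 'M[R]_(a, b)) i j : k != l ->
  (givens k l al be *m A) i j =
  if i == k then al * A k j - be * A l j
  else if i == l then be * A k j + al * A l j else A i j.
Proof.
move=> kl; have dA (x y : 'I_a) : (delta_mx x y *m A) i j = (i == x)%:R * A y j.
  rewrite mxE (bigD1 y)//= big1 ?addr0 => [|z zy]; first by rewrite mxE eqxx andbT.
  by rewrite mxE (negbTE zy) andbF mul0r.
rewrite !mulmxDl -!scalemxAl mulmxDl mulmxBl mul1mx.
have -> : forall (X0 X1 X2 X3 X4 : 'M[R]_(a, b)) x y,
    (X0 + x *: (X1 + X2) + y *: (X3 - X4)) i j =
    X0 i j + x * (X1 i j + X2 i j) + y * (X3 i j - X4 i j) by move=> *; rewrite !mxE.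
rewrite !dA; case: (eqVneq i k) => [->|ik].
  by rewrite (negbTE kl)/=; ring.
by case: eqVneq => [->|il] /=; ring.
Qed.

Lemma givens_orthogonal a (k l : 'I_a) (al be : R) : k != l ->
  al ^+ 2 + be ^+ 2 = 1 -> (givens k l al be)^T *m givens k l al be = 1%:M.
Proof.
move=> kl ab1.
have -> : (givens k l al be)^T = givens k l al (- be).
  rewrite /givens linearD/= linearD/= trmx1 !linearZ/= linearD/= linearB/= !trmx_delta.
  by rewrite scaleNr -scalerN opprB.
apply/matrixP => i j; rewrite -[givens k l al be]mulmx1 !givensE// !eqxx.
rewrite [l == k]eq_sym (negbTE kl).
case: (eqVneq i k) => [->|ik]; last case: (eqVneq i l) => [->|il] //.
  by rewrite -[RHS]mul1r -ab1; ring.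
by rewrite -[RHS]mul1r -ab1; ring.
Qed.

Lemma preserves_iid_givens a (k l : 'I_a) (al be : R) : k != l ->
  al ^+ 2 + be ^+ 2 = 1 -> al != - 1 -> preserves_iid (givens k l al be).
Proof.
move=> kl ab1 alN1 b d T P Z iZ; set G := givens k l al be.
(* Rotating two rows rotates one pair of entries in each column. The columns in [js] are those
   already treated, so each induction step is a single [rotate_family]. *)
pose Zs (js : seq 'I_b) (ij : 'I_a * 'I_b) w :=
  if ij.2 \in js then mul_family G Z ij w else Z ij w.
have -> : mul_family G Z = Zs (enum 'I_b).
  by apply/funext => ij; apply/funext => w; rewrite /Zs mem_enum.
elim: (enum 'I_b) (enum_uniq 'I_b) => [_|j js IH /= /andP[jjs ujs]].
  exact: iZ.
have klj : (k, j) != (l, j) by rewrite xpair_eqE (negbTE kl).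
have -> : Zs (j :: js) = rotate_family (k, j) (l, j) al be (Zs js).
  apply/funext => -[i j']; apply/funext => w.
  rewrite /rotate_family /Zs /= !xpair_eqE inE (negbTE jjs).
  case: (eqVneq j' j) => [->|_] /=; last by rewrite !andbF.
  by rewrite !andbT (negbTE jjs) /mul_family /= givensE// !mxE.
by apply: iid_normal_rotate => //; exact: IH.
Qed.

Lemma preserves_iid1 a : preserves_iid (1%:M : 'M[R]_a).
Proof.
move=> b d T P Z iZ; rewrite (_ : mul_family _ _ = Z)//.
by apply/funext => -[i j]; apply/funext => w; rewrite /mul_family mul1mx mxE.
Qed.

Lemma preserves_iidM a (Q1 Q2 : 'M[R]_a) : preserves_iid Q1 -> preserves_iid Q2 ->
  preserves_iid (Q1 *m Q2).
Proof.
move=> iQ1 iQ2 b d T P Z iZ; have := iQ1 _ _ _ _ _ (iQ2 _ _ _ _ _ iZ).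
rewrite (_ : mul_family Q1 _ = mul_family (Q1 *m Q2) Z)//.
apply/funext => -[i j]; apply/funext => w.
by rewrite /mul_family mx_at_mul_family mulmxA.
Qed.

Lemma exists_preserves_iid a (p : 'cV[R]_a.+1) : exists (Q : 'M[R]_a.+1) (c : R),
  [/\ Q^T *m Q = 1%:M, Q *m p = c *: delta_mx 0 0 & preserves_iid Q].
Proof.
suff /(_ a (leqnn a)) [Q [QQ Qp iQ]] : forall n, (n <= a)%N ->
    exists Q : 'M[R]_a.+1, [/\ Q^T *m Q = 1%:M,
      forall i : 'I_a.+1, (0 < i <= n)%N -> (Q *m p) i 0 = 0 & preserves_iid Q].
  exists Q, ((Q *m p) 0 0); split => //; apply/colP => i.
  rewrite [RHS]mxE [X in _ * X]mxE eqxx andbT.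
  have [->|i0] := eqVneq i 0; first by rewrite mulr1.
  by rewrite mulr0 Qp// lt0n i0 -ltnS ltn_ord.
elim=> [_|n IH na].
  exists 1%:M; split; first by rewrite trmx1 mulmx1.
    by move=> i; case: (nat_of_ord i).
  exact: preserves_iid1.
have [Q [QQ Qp iQ]] := IH (ltnW na).
pose k : 'I_a.+1 := inord n.+1.
have kE : k = n.+1 :> nat by rewrite inordK.
have k0 : 0 != k by rewrite -val_eqE /= kE.
set x := (Q *m p) 0 0; set y := (Q *m p) k 0.
(* An entry already zero is left alone. Otherwise the sine of the rotation is nonzero, and this is
   what excludes the angle pi. *)
have [y0|y0] := eqVneq y 0.
  exists Q; split => // i /andP[i0]; rewrite leq_eqVlt => /orP[/eqP ik|ilt].
    by rewrite (_ : i = k)//; apply: val_inj; rewrite /= ik kE.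
  by apply: Qp; rewrite i0.
pose h := Num.sqrt (x ^+ 2 + y ^+ 2).
have h2 : h ^+ 2 = x ^+ 2 + y ^+ 2 by rewrite sqr_sqrtr// addr_ge0 ?sqr_ge0.
have y2 : 0 < y ^+ 2 by rewrite exprn_even_gt0.
have h0 : h != 0 by rewrite -sqrf_eq0 h2 gt_eqF// ltr_wpDl// sqr_ge0.
have ab1 : (x / h) ^+ 2 + (- (y / h)) ^+ 2 = 1.
  by rewrite sqrrN !expr_div_n -mulrDl -h2 divff// sqrf_eq0.
have aN1 : x / h != - 1.
  apply: contra_neq y0 => xh; have /eqP : (y / h) ^+ 2 = 0.
    by move: ab1; rewrite xh sqrrN; lra.
  by rewrite sqrf_eq0 mulf_eq0 invr_eq0 (negbTE h0) orbF => /eqP.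
exists (givens 0 k (x / h) (- (y / h)) *m Q); split.
- by rewrite trmx_mul mulmxA -(mulmxA Q^T) givens_orthogonal// mulmx1.
- move=> i /andP[i0 ilt]; rewrite -mulmxA givensE// -/x -/y.
  rewrite -val_eqE /= (gtn_eqF i0); case: eqP => [_|/eqP ik]; first by field.
  apply: Qp; rewrite i0 -ltnS ltn_neqAle ilt andbT.
  by rewrite -val_eqE /= kE in ik.
- by apply: preserves_iidM => //; exact: preserves_iid_givens.
Qed.

End Givens.

Section Consequences.
Context {R : realType}.
Notation leb := (@lebesgue_measure R).

Lemma normal_prob_translate (mu s : R) (B : set R) : 0 < s -> measurable B ->
  normal_prob mu s [set x | B (x - mu)] = normal_prob 0 s B.
Proof.
move=> s0 mB; rewrite /normal_prob integral_mkcond [in RHS]integral_mkcond.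
pose f x : \bar R := ((EFin \o normal_pdf 0 s) \_ B) x.
rewrite -[RHS](ge0_integral_translate (- mu) (f := f)); last 2 first.
- move=> x; rewrite /f patchE; case: ifP => // _.
  by rewrite lee_fin normal_pdf_ge0.
- apply/(measurable_restrictT _ mB).
  by apply/measurable_EFinP/measurable_funTS; exact: measurable_normal_pdf.
apply: eq_integral => x _; rewrite /f !patchE.
have -> : (x - mu \in B) = (x \in [set x | B (x - mu)]).
  by apply/idP/idP; rewrite !inE.
case: ifP => // _ /=; congr (_%:E).
by rewrite !normal_pdfE ?gt_eqF// /normal_fun subr0.
Qed.

Lemma iid_normal_comp (s : R) (I J : finType) (h : J -> I) d (T : measurableType d)
    (P : probability T R) (X : I -> T -> R) : injective h ->
  iid_normal s P X -> iid_normal s P (fun j => X (h j)).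
Proof.
move=> hI iX; have [mX PX] := iX; split; first by move=> j; exact: mX.
move=> B mB; pose B' i := if [pick j | h j == i] is Some j then B j else setT.
have B'h j : B' (h j) = B j.
  by rewrite /B'; case: pickP => [j' /eqP/hI ->//|/(_ j)]; rewrite eqxx.
have mB' i : measurable (B' i) by rewrite /B'; case: pickP.
rewrite (_ : [set w | _] = [set w | forall i, i \in (h @: [set: J])%SET -> B' i (X i w)]).
  rewrite (iid_normal_partial _ iX mB') big_imset/=; last by move=> i j _ _ /hI.
  rewrite (eq_bigl predT) => [|j]; last by rewrite finset.in_setT.
  by apply: eq_bigr => j _; rewrite B'h.
apply/seteqP; split => w /= H.
  by move=> _ /imsetP[j _ ->]; rewrite B'h.
by move=> j; have := H (h j) (imset_f h (finset.in_setT j)); rewrite B'h.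
Qed.

(** Centring the entries moves the mean [mu] into the deterministic shift of the matrix. *)
Lemma gaussian_matrix_iid d (T : measurableType d) (P : probability T R) p q
    (mu s : R) (G : 'M[{RV P >-> R}]_(p, q)) : 0 < s -> gaussian_matrix mu s G ->
  iid_normal s P (fun ij w => G ij.1 ij.2 w - mu).
Proof.
move=> s0 [indep law]; split.
  by move=> ij; apply: measurable_funB.
move=> B mB; pose B' ij := [set x | B ij (x - mu)].
have mB' ij : measurable (B' ij).
  have mt : measurable_fun [set: R] (fun x : R => x - mu) by exact: measurable_funB.
  by rewrite -[X in measurable X]setTI; exact: mt.
have := indep finset.setT B' (fun ij _ => mB' ij).
rewrite (_ : \bigcap_(i in _) _ = [set w | forall ij, B ij (G ij.1 ij.2 w - mu)]).
  move=> ->; rewrite (eq_bigl predT); last by move=> ij; rewrite inE.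
  apply: eq_bigr => -[i j] _; rewrite -(normal_prob_translate mu s0 (mB _)).
  by rewrite -(law i j _ (mB' _)).
apply/seteqP; split => w /= H ij; last by move=> _; exact: H.
by apply: H; rewrite /= inE.
Qed.

Section Vector.
Variable s : R.
Hypothesis s0 : 0 < s.
Notation gam := (normal_prob (0 : R) s).

Lemma iid_normal_marginal (I : finType) d (T : measurableType d)
    (P : probability T R) (X : I -> T -> R) i (B : set R) :
  iid_normal s P X -> measurable B -> P (X i @^-1` B) = gam B.
Proof.
move=> iX mB; have := @iid_normal_partial _ _ _ _ _ _ _ (pred1 i) (fun=> B) iX (fun=> mB).
rewrite big_pred1_eq => <-; congr (P _).
by apply/seteqP; split => w /= => [Bw j /eqP ->//|/(_ i)]; apply.
Qed.

Variables (a : nat) (d : measure_display) (T : measurableType d) (P : probability T R).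
Variables (Z : 'I_a * 'I_1 -> T -> R) (q : 'cV[R]_a).
Hypotheses (iZ : iid_normal s P Z) (q1 : l2norm q = 1).

(** A rotation taking [q] to [c] times the first basis vector turns the linear form into one
    coordinate; [c] is a sign because [q] is a unit vector. *)
Lemma iid_normal_dot : exists (c : R) (g : T -> R),
  [/\ c ^+ 2 = 1, measurable_fun [set: T] g, forall w, dot q (mx_at Z w) = c * g w &
      forall B, measurable B -> P (g @^-1` B) = gam B].
Proof.
case: a q Z iZ q1 => [|a'] q' Z' iZ' q'1.
  by move: q'1; rewrite /l2norm big_ord0 sqrtr0 => /esym/eqP; rewrite oner_eq0.
have [Q [c [QQ Qq iQ]]] := exists_preserves_iid s0 q'.
have iQZ := iQ _ _ _ _ _ iZ'.
have dQ u v : dot u v = dot (Q *m u) (Q *m v) by rewrite dotM mulmxA QQ mul1mx.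
have d0 (v : 'cV[R]_a'.+1) : dot (delta_mx 0 0) v = v 0 0.
  by rewrite /dot trmx_delta -rowE mxE.
exists c, (mul_family Q Z' (0, 0)); split.
- have := l2norm_sqr q'; rewrite q'1 expr1n dQ Qq dotZl dotZr d0 mxE !eqxx mulr1.
  by rewrite expr2 => <-.
- exact: iQZ.1.
- by move=> w; rewrite dQ Qq dotZl d0.
- by move=> B; exact: iid_normal_marginal.
Qed.

(** A bounded density controls an interval wherever it is centred. Here the shift [e0], and with it
    the mean and the fixed matrices added to the Gaussian ones, drops out. *)
Lemma iid_normal_small_ball (e0 e : R) : 0 <= e ->
  (P [set w | (`|e0 + dot q (mx_at Z w)| <= e)%R] <= (2 * normal_peak s * e)%R%:E)%E.
Proof.
move=> e_ge0; have [c [g [c2 mg qg Pg]]] := iid_normal_dot.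
rewrite (_ : [set w | _] =
    g @^-1` `[(- (c * e0) - e)%R, (- (c * e0) + e)%R]%classic).
  by rewrite Pg//; exact: normal_prob_small_ball.
have /orP[/eqP c1|/eqP c1] : (c == 1) || (c == - 1) by rewrite -sqrf_eq1 c2.
  by apply/seteqP; split => w /=; rewrite qg in_itv/= ler_norml c1 => /andP[? ?];
    apply/andP; split; lra.
by apply/seteqP; split => w /=; rewrite qg in_itv/= ler_norml c1 => /andP[? ?];
  apply/andP; split; lra.
Qed.

Lemma iid_normal_tail :
  ((tail_mass s)%:E <=
   P [set w | (3 / 4 * s < `|dot q (mx_at Z w)|)%R])%E.
Proof.
have [c [g [c2 mg qg Pg]]] := iid_normal_dot.
have cn : `|c| = 1 by apply/eqP; rewrite -(@eqrXn2 _ 2)// ?expr1n real_normK ?num_real// c2.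
have mB : measurable [set x : R | 3 / 4 * s < `|x|].
  rewrite (_ : [set x | _] = (fun x : R => `|x|) @^-1` `]3 / 4 * s, +oo[%classic); last first.
    by apply/seteqP; split => x /=; rewrite in_itv/= andbT.
  rewrite -[X in measurable X]setTI; exact: normr_measurable.
rewrite (_ : [set w | _] = g @^-1` [set x | 3 / 4 * s < `|x|]); last first.
  by apply/seteqP; split => w /=; rewrite qg normrM cn mul1r.
rewrite Pg//; apply: normal_prob_tail => // x [] /=; rewrite in_itv/= ?andbT => h.
  by rewrite ltr_normr; apply/orP; right; rewrite ltrNr.
by rewrite ltr_normr h.
Qed.

End Vector.

Lemma iid_normal_sqr (s : R) a d (T : measurableType d) (P : probability T R)
    (Z : 'I_a * 'I_1 -> T -> R) (u : 'cV[R]_a) : 0 < s -> iid_normal s P Z ->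
  (\int[P]_w ((dot u (mx_at Z w)) ^+ 2)%:E <= (s ^+ 2 * dot u u)%:E)%E.
Proof.
move=> s0 iZ; have [u0|u0] := eqVneq (l2norm u) 0.
  rewrite (l2norm_eq0 u0) (_ : dot 0 0 = 0) ?mulr0; last by rewrite /dot mulmx0 mxE.
  rewrite integral0_eq// => w _; congr (_%:E).
  by rewrite /dot trmx0 mul0mx mxE expr0n.
have up : 0 < l2norm u by rewrite lt_def u0 l2norm_ge0.
pose q := (l2norm u)^-1 *: u.
have q1 : l2norm q = 1 by rewrite l2normZ ger0_norm ?invr_ge0 ?l2norm_ge0// mulVf.
have uq : u = l2norm u *: q by rewrite scalerA divff// scale1r.
have [c [g [c2 mg qg Pg]]] := iid_normal_dot s0 iZ q1.
have mg' : measurable_fun [set: T] (fun w => g w : measurableTypeR R) by exact: mg.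
pose G : {RV P >-> measurableTypeR R} :=
  @mfun_Sub _ _ T (measurableTypeR R) g (mem_set mg').
have mx2 : measurable_fun [set: R] (fun x : R => (x ^+ 2)%:E).
  by apply/measurable_EFinP; exact: measurable_funX.
have x20 (x : R) : (0 <= (x ^+ 2)%:E)%E by rewrite lee_fin sqr_ge0.
have -> : (\int[P]_w ((dot u (mx_at Z w)) ^+ 2)%:E =
    \int[P]_w ((l2norm u ^+ 2)%:E * (G w ^+ 2)%:E))%E.
  apply: eq_integral => w _; rewrite -EFinM uq dotZl qg !exprMn c2 mul1r.
  by rewrite -uq.
have mG2 : measurable_fun [set: T] (fun w => (G w ^+ 2)%:E).
  by apply/measurable_EFinP; apply: measurable_funX.
have G20 w : (0 <= (G w ^+ 2)%:E)%E by rewrite lee_fin sqr_ge0.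
rewrite ge0_integralZl ?lee_fin ?sqr_ge0//.
rewrite -l2norm_sqr [X in (_ <= X%:E)%E]mulrC [X in (_ <= X)%E]EFinM.
apply: lee_pmul; rewrite ?lee_fin ?sqr_ge0//; first exact: integral_ge0.
have -> : (\int[P]_w (G w ^+ 2)%:E = \int[distribution P G]_x (x ^+ 2)%:E)%E.
  by rewrite ge0_integral_distribution.
apply: le_trans (normal_prob_sqr s0); rewrite le_eqVlt; apply/orP; left; apply/eqP.
apply: eq_measure_integral.
by move=> B mB _; exact: Pg.
Qed.

End Consequences.

(** * Tail bounds for pseudo-inverses *)

Section Measurability.
Context {R : realType} {d : measure_display} {T : measurableType d}.

Lemma measurable_superlevel (f : T -> R) (t : R) : measurable_fun [set: T] f ->
  measurable [set w | t <= f w].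
Proof.
move=> mf; rewrite (_ : [set w | _] = f @^-1` `[t, +oo[%classic).
  by rewrite -[X in measurable X]setTI; exact: mf.
by apply/seteqP; split => w /=; rewrite in_itv/= andbT.
Qed.

Lemma measurable_sublevel (f : T -> R) (t : R) : measurable_fun [set: T] f ->
  measurable [set w | f w <= t].
Proof.
move=> mf; rewrite (_ : [set w | _] = f @^-1` `]-oo, t]%classic).
  by rewrite -[X in measurable X]setTI; exact: mf.
by apply/seteqP; split => w /=; rewrite in_itv.
Qed.

Lemma measurable_mx_at a b (Y : 'I_a * 'I_b -> T -> R) i j :
  (forall ij, measurable_fun [set: T] (Y ij)) ->
  measurable_fun [set: T] (fun w => mx_at Y w i j).
Proof.
move=> mY; rewrite (_ : (fun w => _) = Y (i, j)); first exact: mY.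
by apply/funext => w; rewrite mxE.
Qed.

Lemma measurable_l2norm n (v : T -> 'cV[R]_n) :
  (forall i, measurable_fun [set: T] (fun w => v w i 0)) ->
  measurable_fun [set: T] (fun w => l2norm (v w)).
Proof.
move=> mv; have mS : measurable_fun [set: R] (@Num.sqrt R).
  by apply: continuous_measurable_fun; exact: sqrt_continuous.
apply: (measurableT_comp mS).
by apply: measurable_sum => i; exact: measurable_funX.
Qed.

Lemma measurable_mulmx_col m n (A : T -> 'M[R]_(m, n)) (v : T -> 'cV[R]_n) :
  (forall i j, measurable_fun [set: T] (fun w => A w i j)) ->
  (forall i, measurable_fun [set: T] (fun w => v w i 0)) ->
  forall i, measurable_fun [set: T] (fun w => (A w *m v w) i 0).
Proof.
move=> mA mv i; rewrite (_ : (fun w => _) = (fun w => \sum_j A w i j * v w j 0)).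
  by apply: measurable_sum => j; exact: measurable_funM.
by apply/funext => w; rewrite mxE.
Qed.

Lemma measurable_dot n (u : 'cV[R]_n) (v : T -> 'cV[R]_n) :
  (forall i, measurable_fun [set: T] (fun w => v w i 0)) ->
  measurable_fun [set: T] (fun w => dot u (v w)).
Proof.
move=> mv; rewrite (_ : (fun w => _) = (fun w => \sum_i u i 0 * v w i 0)).
  by apply: measurable_sum => i; exact: measurable_funM.
by apply/funext => w; rewrite dotE.
Qed.

(** The factor [C] serves both the rotated array, where it is [Q^T], and the plain one, where it is
    the identity. *)
Lemma measurable_moore_penrose_affine l a b n (L : 'M[R]_(l, a)) (D : 'M[R]_(a, b))
    (C : 'M[R]_a) (N : 'M[R]_(b, n)) (Z : 'I_a * 'I_b -> T -> R) :
  (forall ij, measurable_fun [set: T] (Z ij)) -> forall i j,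
  measurable_fun [set: T]
    (fun w => moore_penrose (L *m (D + C *m mx_at Z w) *m N) i j).
Proof.
move=> mZ i j.
pose cst_mx p q (A : 'M[R]_(p, q)) : 'M[{mfun T >-> R}]_(p, q) :=
  map_mx (fun x => cst x : {mfun T >-> R}) A.
have cst_mxE p q (A : 'M[R]_(p, q)) w : realize (cst_mx _ _ A) w = A.
  by apply/matrixP => x y; rewrite !mxE.
pose A : 'M[{mfun T >-> R}]_(a, b) :=
  \matrix_(x, y) (mfun_Sub (mem_set (mZ (x, y))) : {mfun T >-> R}).
have AE w : realize A w = mx_at Z w by apply/matrixP => x y; rewrite !mxE.
have := @measurable_moore_penrose _ T R _ _
  (cst_mx _ _ L *m (cst_mx _ _ D + cst_mx _ _ C *m A) *m cst_mx _ _ N) i j.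
congr (measurable_fun _ _); apply/funext => w; congr (moore_penrose _ i j).
by rewrite !realizeM realizeD realizeM !cst_mxE AE.
Qed.

End Measurability.

(** * The probability estimate for a fixed vector *)

Section FixedVector.
Context {R : realType} {d : measure_display} {T : measurableType d}.
Variables (P : probability T R) (s : R).
Hypothesis s0 : 0 < s.

(* Replacing one row of an i.i.d. array by the same row of an independent copy
   does not change its law. *)
Definition resample_row a b (Z : 'I_a.+1 * 'I_b -> T -> R)
  (ij : 'I_a.+1 * 'I_b) (w : T * T) : R :=
  if ij.1 == ord0 then Z ij w.2 else Z ij w.1.

Lemma iid_normal_resample_row a b (Z : 'I_a.+1 * 'I_b -> T -> R) :
  iid_normal s P Z -> iid_normal s (P \x P)%E (resample_row Z).
Proof.
move=> iZ; have [mZ _] := iZ; split.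
  move=> ij; rewrite /resample_row; case: (ij.1 == ord0).
    by apply: (measurableT_comp (mZ ij)).
  by apply: (measurableT_comp (mZ ij)).
move=> B mB; rewrite (bigID (fun ij => ij.1 != ord0))/=.
have mD (D : pred ('I_a.+1 * 'I_b)) : measurable [set w | forall ij, D ij -> B ij (Z ij w)].
  rewrite (_ : [set w | _] = \bigcap_(i in [set i | D i]) (Z i @^-1` B i)).
    apply: fin_bigcap_measurable => [|i _]; first exact: finite_finset.
    by rewrite -[X in measurable X]setTI; exact: mZ.
  by apply/seteqP; split => w h i; exact: h.
rewrite -!(iid_normal_partial _ iZ mB) -product_measure1E; [|exact: mD|exact: mD].
congr (product_measure1 _ _ _); apply/seteqP; split => -[w w'] /= h.
  split => ij ij0; have := h ij; rewrite /resample_row.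
    by rewrite (negbTE ij0).
  by move: ij0; rewrite negbK => ->.
move=> ij; rewrite /resample_row; case: ifPn => ij0; last exact: h.1.
by apply: h.2; rewrite negbK.
Qed.

Variables (l a b n : nat) (L : 'M[R]_(l, a.+1)) (D : 'M[R]_(a.+1, b)) (N : 'M[R]_(b, n)).
Hypothesis rLN : (\rank L <= \rank N)%N.
Variables (Z : 'I_a.+1 * 'I_b -> T -> R).
Hypothesis iZ : iid_normal s P Z.

(** Conditioning on all rows of the rotated array but the first is an integral over sections of the
    resampled event. On each section only row 0 is random, and the deterministic estimate forces its
    product with q into a short interval, centred according to the rotated shift [Q *m D]. *)
Lemma fixed_vector_bound (p : 'cV[R]_a.+1) (t : R) : 0 < t ->
  (P [set w | (t <= l2norm (moore_penrose (L *m (D + mx_at Z w) *m N) *m (L *m p)))%R] <=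
   (2 * normal_peak s *
     (spectral_norm (moore_penrose N) * l2norm (moore_penrose L *m L *m p) / t))%R%:E)%E.
Proof.
move=> t0; set Pip := moore_penrose L *m L *m p; set K := _ / t.
have K0 : 0 <= K.
  by apply: divr_ge0 (ltW t0); rewrite mulr_ge0 ?spectral_norm_ge0 ?l2norm_ge0.
have kK0 : 0 <= 2 * normal_peak s * K.
  by apply: mulr_ge0 K0; rewrite mulr_ge0 ?normal_peak_ge0.
have [Pip0|Pip0] := eqVneq Pip 0.
  rewrite (_ : [set w | _] = set0).
    by rewrite measure0 lee_fin.
  apply/seteqP; split => // w /=; have -> : L *m p = L *m Pip.
    by rewrite /Pip !mulmxA; have [-> _ _ _] := moore_penroseP L.
  by rewrite Pip0 !mulmx0 l2norm0 leNgt t0.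
have [Q [c [QQ Qp iQ]]] := exists_preserves_iid s0 Pip.
have iQZ := iQ _ _ _ _ _ iZ; set Zt := mul_family Q Z in iQZ.
pose F (x : 'M[R]_(a.+1, b)) :=
  l2norm (moore_penrose (L *m (D + Q^T *m x) *m N) *m (L *m p)).
pose A := [set x : 'I_a.+1 * 'I_b -> R | t <= F (\matrix_(i, j) x (i, j))].
have mF d' (T' : measurableType d') (Y : 'I_a.+1 * 'I_b -> T' -> R) :
    (forall ij, measurable_fun [set: T'] (Y ij)) ->
    measurable [set w | t <= F (mx_at Y w)].
  move=> mY; apply: measurable_superlevel.
  apply: measurable_l2norm => i; apply: measurable_mulmx_col => //.
  exact: measurable_moore_penrose_affine.
have mA : measurable (A : set (g_sigma_algebraType (@boxes R ('I_a.+1 * 'I_b)%type))).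
  exact: (mF _ (g_sigma_algebraType (@boxes R ('I_a.+1 * 'I_b)%type))
    (fun ij x => x ij) (@measurable_coord R _)).
have iY := iid_normal_resample_row iQZ.
rewrite (_ : [set w | _] = [set w | A (Zt^~ w)]); last first.
  by apply/seteqP; split => w; rewrite /A/= /F -/(mx_at Zt w) mx_at_mul_family
    (mulmxA Q^T) QQ mul1mx.
rewrite (iid_normal_law iQZ iY mA).
set E := [set w | _]; have mE : measurable E by exact: (mF _ _ _ iY.1).
rewrite -[X in (X <= _)%E]/(\int[P]_w P (xsection E w))%E.
apply: (@le_trans _ _ (\int[P]_w (2 * normal_peak s * K)%:E)%E); last first.
  by rewrite integral_cst//= probability_setT mule1.
apply: ge0_le_integral => //=.
  exact: measurable_fun_xsection.
move=> w _.
(* [q] is chosen from [w] alone. The bound on the section is the same constant for every [w], so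
   pointwise existence of [q] is enough. *)
have [q [q1 [y qy] Bq]] := exists_normal_vector rLN Pip0 QQ Qp (Q *m D + mx_at Zt w).
pose h (ji : 'I_b * 'I_1) : 'I_a.+1 * 'I_b := (ord0, ji.1).
have hI : injective h by move=> [i i'] [j j'] [->]; rewrite (ord1 i') (ord1 j').
have iZ0 := iid_normal_comp hI iQZ.
set Z0 := (fun j => _) in iZ0.
have small := iid_normal_small_ball s0 iZ0 q1 ((Q *m D *m q) 0 0) K0.
apply: le_trans small; apply: le_measure; rewrite ?inE.
- exact: measurable_xsection.
- apply: measurable_sublevel; apply: measurableT_comp; first exact: normr_measurable.
  apply: measurable_funD => //; apply: measurable_dot => i.
  by apply: measurable_mx_at; exact: iZ0.1.
move=> w'; rewrite /xsection/= inE /E /A /= -/(mx_at (resample_row Zt) (w, w')).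
set B := mx_at _ _ => tF.
have BE : Q *m D + B = Q *m (D + Q^T *m B).
  have QQ' : Q *m Q^T = 1%:M by exact: mulmx1C.
  by rewrite mulmxDr mulmxA QQ' mul1mx.
have Bq' := Bq; rewrite (@normal_vector_row0 _ _ _ _ L p Q c Pip0 QQ Qp _ (Q *m D + B)) in Bq'; last first.
  by move=> i j i0; rewrite !mxE /resample_row (negbTE i0).
have := pinv_image_bound Pip0 QQ Qp q1 (ex_intro _ y qy) Bq'.
rewrite BE (mulmxA Q^T) QQ mul1mx -BE -/(F B) => FB.
have -> : (Q *m D *m q) 0 0 + dot q (mx_at Z0 w') = ((Q *m D + B) *m q) 0 0.
  rewrite mulmxDl [RHS]mxE; congr (_ + _); rewrite dotE [RHS]mxE.
  by apply: eq_bigr => j _; rewrite !mxE /= mulrC.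
rewrite /K ler_pdivlMr// mulrC; apply: le_trans FB.
by rewrite ler_wpM2r.
Qed.

End FixedVector.

(** * Averaging over a Gaussian vector *)

Section Averaging.
Context {R : realType} {d : measure_display} {T : measurableType d}.
Variables (P : probability T R) (s : R).
Hypothesis s0 : 0 < s.

(** The squared norms of the rows of the projection add up to its trace, the rank of [L]; this
    bounds the second moment by [h ^+ 2], and the mean follows. *)
Lemma expectation_projection_norm a (Y : 'I_a * 'I_1 -> T -> R) l (L : 'M[R]_(l, a)) :
  iid_normal s P Y ->
  (\int[P]_w (l2norm (moore_penrose L *m L *m mx_at Y w))%:E <=
   (s * Num.sqrt (\rank L)%:R)%:E)%E.
Proof.
move=> iY; have [mY _] := iY; set Pi := moore_penrose L *m L.
have [L0|rL] := eqVneq (\rank L) 0%N.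
  have Pi0 : Pi = 0.
    by apply/eqP; rewrite -mxrank_eq0 -leqn0 -L0 mxrankM_maxr.
  rewrite L0 sqrtr0 mulr0 integral0_eq// => w _.
  by rewrite Pi0 mul0mx l2norm0.
set h := s * _.
have h0 : 0 < h by rewrite mulr_gt0// sqrtr_gt0 ltr0n lt0n.
have mv i : measurable_fun [set: T] (fun w => mx_at Y w i 0).
  exact: measurable_mx_at.
pose r i := (row i Pi)^T.
have rE w i : (Pi *m mx_at Y w) i 0 = dot (r i) (mx_at Y w).
  by rewrite /dot trmxK -row_mul [RHS]mxE.
have md i : measurable_fun [set: T] (fun w => dot (r i) (mx_at Y w)).
  exact: measurable_dot.
have md2 i : measurable_fun [set: T] (fun w => (dot (r i) (mx_at Y w) ^+ 2)%:E).
  by apply/measurable_EFinP; exact: measurable_funX.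
have nE w : ((l2norm (Pi *m mx_at Y w)) ^+ 2 = \sum_i dot (r i) (mx_at Y w) ^+ 2)%R.
  by rewrite l2norm_sqr dotE; apply: eq_bigr => i _; rewrite rE expr2.
have int2 : (\int[P]_w (l2norm (Pi *m mx_at Y w) ^+ 2)%:E <= (h ^+ 2)%:E)%E.
  under eq_integral do rewrite nE -sumEFin.
  rewrite ge0_integral_sum//; last by move=> i w _; rewrite lee_fin sqr_ge0.
  apply: (@le_trans _ _ (\sum_i (s ^+ 2 * dot (r i) (r i))%:E)%E).
    by apply: lee_sum => i _; exact: iid_normal_sqr.
  rewrite sumEFin lee_fin -mulr_sumr /h exprMn sqr_sqrtr ?ler0n//.
  rewrite ler_wpM2l ?sqr_ge0// -mxtrace_projection -/Pi.
  have [e1 e2 e3 e4] := moore_penroseP L.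
  rewrite le_eqVlt; apply/orP; left; apply/eqP.
  transitivity (\tr (Pi *m Pi^T)).
    apply: eq_bigr => i _; rewrite /dot /r trmxK mxE [RHS]mxE.
    by apply: eq_bigr => j _; rewrite !mxE.
  by rewrite /Pi e4 mulmxA e2.
have mn : measurable_fun [set: T] (fun w => l2norm (Pi *m mx_at Y w)).
  by apply: measurable_l2norm => i; under eq_fun do rewrite rE; exact: md.
(* AM-GM: 2 x h <= x ^ 2 + h ^ 2 *)
apply: (@le_trans _ _ (\int[P]_w (((2 * h)^-1)%:E * (l2norm (Pi *m mx_at Y w) ^+ 2)%:E +
   (h / 2)%:E))%E).
  apply: ge0_le_integral => //=.
  - by move=> w _; rewrite lee_fin l2norm_ge0.
  - exact/measurable_EFinP.
  - apply: emeasurable_funD => //; apply: emeasurable_funM => //.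
    by apply/measurable_EFinP; exact: measurable_funX.
  - move=> w _; rewrite -EFinM -EFinD lee_fin.
    set x := l2norm _; rewrite -subr_ge0.
    have -> : (2 * h)^-1 * x ^+ 2 + h / 2 - x = (2 * h)^-1 * (x - h) ^+ 2.
      by field; rewrite gt_eqF.
    by rewrite mulr_ge0 ?sqr_ge0// invr_ge0 mulr_ge0// ltW.
have mn2 : measurable_fun [set: T] (fun w => (l2norm (Pi *m mx_at Y w) ^+ 2)%:E).
  by apply/measurable_EFinP; exact: measurable_funX.
have i0 : 0 <= (2 * h)^-1 by rewrite invr_ge0 mulr_ge0// ltW.
have n0 w : (0 <= (l2norm (Pi *m mx_at Y w) ^+ 2)%:E)%E by rewrite lee_fin sqr_ge0.
rewrite ge0_integralD//; last 3 first.
- by move=> w _; rewrite mule_ge0.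
- exact: emeasurable_funM.
- by move=> w _; rewrite lee_fin divr_ge0// ltW.
rewrite integral_cst//= probability_setT mule1 ge0_integralZl//.
apply: (@le_trans _ _ (((2 * h)^-1)%:E * (h ^+ 2)%:E + (h / 2)%:E)%E).
  by apply: leeD => //; apply: lee_pmul => //; exact: integral_ge0.
rewrite -EFinM -EFinD lee_fin le_eqVlt; apply/orP; left; apply/eqP; field.
by rewrite gt_eqF.
Qed.

End Averaging.

Lemma integral_xsection_ysection (R : realType) d1 d2 (T1 : measurableType d1)
    (T2 : measurableType d2) (P1 : probability T1 R) (P2 : probability T2 R)
    (A : set (T1 * T2)) : measurable A ->
  (\int[P1]_x P2 (xsection A x) = \int[P2]_y P1 (ysection A y))%E.
Proof.
move=> mA; have := indic_fubini_tonelli P1 P2 mA.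
by rewrite (indic_fubini_tonelli_FE P2 mA) (indic_fubini_tonelli_GE P1 mA).
Qed.

(* With v a unit vector that nearly realizes the norm of X^T and u = X^T v, one has
   |X y| >= |<v, X y>| = |<u, y>|, and <u, y> is Gaussian of standard deviation s |u|. *)
Lemma gaussian_test_vector (R : realType) d (T : measurableType d) (P : probability T R)
    (s : R) a n (X : 'M[R]_(n, a)) (Y : 'I_a * 'I_1 -> T -> R) (t : R) :
  0 < s -> iid_normal s P Y -> 0 < t -> t <= spectral_norm X ->
  ((tail_mass s)%:E <=
   P [set w | (test_ratio * s * t <= l2norm (X *m mx_at Y w))%R])%E.
Proof.
move=> s0 iY t0 tX.
have mY i : measurable_fun [set: T] (fun w => mx_at Y w i 0).
  by apply: measurable_mx_at; exact: iY.1.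
(* Strictly below [t], so that some vector of norm at most 1 exceeds it; 2996/2997 times 3/4 is
   exactly [test_ratio]. *)
pose th := 2996 / 2997 * t; have th0 : 0 < th by rewrite /th; move: t0; lra.
have tX' : th < spectral_norm X^T.
  rewrite spectral_norm_tr; apply: lt_le_trans tX.
  by rewrite /th; move: t0; lra.
have -> : test_ratio * s * t = th * (3 / 4 * s) by rewrite /th /test_ratio; field.
move: th th0 tX' => {t0 tX t} th th0 tX.
have [v v1 tv] := spectral_norm_gt_ex tX; set u := X^T *m v in tv.
have u0 : 0 < l2norm u by apply: lt_trans tv.
pose q := (l2norm u)^-1 *: u.
have q1 : l2norm q = 1 by rewrite l2normZ ger0_norm ?invr_ge0 ?l2norm_ge0// mulVf ?gt_eqF.
apply: le_trans (iid_normal_tail s0 iY q1) _.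
apply: le_measure; rewrite ?inE.
- rewrite (_ : [set w | _] = (fun w => `|dot q (mx_at Y w)|) @^-1` `]3 / 4 * s, +oo[%classic).
    have mN : measurable_fun [set: T] (fun w => `|dot q (mx_at Y w)|).
      by apply: measurableT_comp; [exact: normr_measurable|exact: measurable_dot].
    by rewrite -[X in measurable X]setTI; exact: mN.
  by apply/seteqP; split => w /=; rewrite in_itv/= andbT.
- by apply: measurable_superlevel; apply: measurable_l2norm => i; exact: measurable_mulmx_col.
move=> w /= qY.
have uq : dot u (mx_at Y w) = l2norm u * dot q (mx_at Y w).
  by rewrite -dotZl scalerA divff ?gt_eqF// scale1r.
have h1 : `|dot u (mx_at Y w)| <= l2norm (X *m mx_at Y w).
  rewrite /u -[X]trmxK -dotM trmxK (le_trans (dot_le _ _))//.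
  by rewrite ler_piMl ?l2norm_ge0.
apply: le_trans h1; rewrite uq normrM ger0_norm ?l2norm_ge0//.
by apply: ler_pM (ltW tv) (ltW qY); rewrite ?mulr_ge0// ltW.
Qed.

(** * Combining the two estimates *)

Section Core.
Context {R : realType} {d : measure_display} {T : measurableType d}.
Variables (P : probability T R) (s : R).
Hypothesis s0 : 0 < s.
Variables (l a b n : nat) (L : 'M[R]_(l, a.+1)) (D : 'M[R]_(a.+1, b.+1)) (N : 'M[R]_(b.+1, n)).
Hypothesis rLN : (\rank L <= \rank N)%N.
Variables (Z : 'I_a.+1 * 'I_b.+1 -> T -> R).
Hypothesis iZ : iid_normal s P Z.

Let X w : 'M[R]_(n, a.+1) := moore_penrose (L *m (D + mx_at Z w) *m N) *m L.

Lemma measurable_core i j : measurable_fun [set: T] (fun w => X w i j).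
Proof.
rewrite (_ : (fun w => _) =
  (fun w => \sum_k moore_penrose (L *m (D + mx_at Z w) *m N) i k * L k j)); last first.
  by apply/funext => w; rewrite mxE.
apply: measurable_sum => k; apply: measurable_funM => //.
have := @measurable_moore_penrose_affine _ _ _ _ _ _ _ L D 1%:M N _ iZ.1 i k.
by under eq_fun do rewrite mul1mx.
Qed.

Lemma measurable_spectral_core : measurable_fun [set: T] (fun w => spectral_norm (X w)).
Proof.
pose A : 'M[{mfun T >-> R}]_(n, a.+1) :=
  \matrix_(i, j) (mfun_Sub (mem_set (measurable_core i j)) : {mfun T >-> R}).
have := measurable_spectral_norm A; congr (measurable_fun _ _).
apply/funext => w; congr spectral_norm; apply/matrixP => i j.
by rewrite [LHS]mxE [A i j]mxE.
Qed.

Lemma core_bound (t : R) : 0 < t ->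
  (P [set w | (t <= spectral_norm (X w))%R] <=
   (235 / 100 * (spectral_norm (moore_penrose N) * Num.sqrt (\rank L)%:R) / (s * t))%R%:E)%E.
Proof.
move=> t0; have pk0 : 0 < normal_peak s by rewrite normal_peak_gt0// gt_eqF.
set S := [set w | _]; have mS : measurable S := measurable_superlevel t measurable_spectral_core.
(* Column 0 of [Z] has the law of a test vector. Read at the second point of [T * T] while [X] is
   read at the first, it is independent of [X]; its standard deviation is [s], hence the factor [s]
   in the threshold [c * t]. *)
pose h (ij : 'I_a.+1 * 'I_1) : 'I_a.+1 * 'I_b.+1 := (ij.1, ord0).
have hI : injective h by move=> [i i'] [j j'] [->]; rewrite (ord1 i') (ord1 j').
have iY := iid_normal_comp hI iZ; set Y := (fun j => _) in iY.
have mY i : measurable_fun [set: T] (fun w => mx_at Y w i 0).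
  by apply: measurable_mx_at; exact: iY.1.
have test w := @gaussian_test_vector _ _ _ P s _ _ (X w) Y t s0 iY t0.
have kapP := normal_peak_constant s0.
move: test_ratio (tail_mass s) (@test_ratio_gt0 R) (tail_mass_gt0 s0) kapP test.
move=> al kap al0 kap0 + test.
pose c : R := al * s; have c0 : 0 < c by rewrite mulr_gt0.
have ct0 : 0 < c * t by rewrite mulr_gt0.
pose E := [set z : T * T | c * t <= l2norm (X z.1 *m mx_at Y z.2)].
have mE : measurable E.
  apply: measurable_superlevel.
  apply: measurable_l2norm => i; apply: measurable_mulmx_col => [i' j|i'].
    exact: (measurableT_comp (measurable_core i' j)).
  exact: (measurableT_comp (mY i')).
have lower : (kap%:E * P S <= \int[P]_w P (xsection E w))%E.
  have -> : (kap%:E * P S = \int[P]_(w in S) kap%:E)%E by rewrite integral_cst.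
  apply: (@le_trans _ _ (\int[P]_(w in S) P (xsection E w))%E); last first.
    exact: (ge0_subset_integral P mS measurableT (measurable_fun_xsection P mE)
      (fun _ _ => measure_ge0 P _) (@subsetT _ _)).
  apply: ge0_le_integral => //=.
  - by move=> w _; rewrite lee_fin ltW.
  - by apply: measurable_funTS; exact: measurable_fun_xsection.
  move=> w tX; apply: le_trans (test _ tX) _.
  rewrite le_eqVlt; apply/orP; left; apply/eqP; congr (P _).
  by apply/seteqP; split => w'; rewrite /xsection/= inE.
have upper : (\int[P]_w' P (ysection E w') <=
    (2 * normal_peak s * spectral_norm (moore_penrose N) / (c * t) *
     (s * Num.sqrt (\rank L)%:R))%:E)%E.
  set k := 2 * _ * _ / _; have k0 : 0 <= k.
    by apply: divr_ge0 (ltW ct0); rewrite !mulr_ge0 ?spectral_norm_ge0// ltW.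
  have mn : measurable_fun [set: T]
      (fun w => (l2norm (moore_penrose L *m L *m mx_at Y w))%:E).
    apply/measurable_EFinP; apply: measurable_l2norm => i.
    exact: measurable_mulmx_col.
  have n0 w : (0 <= (l2norm (moore_penrose L *m L *m mx_at Y w))%:E)%E.
    by rewrite lee_fin l2norm_ge0.
  apply: (@le_trans _ _ (\int[P]_w (k%:E * (l2norm (moore_penrose L *m L *m mx_at Y w))%:E))%E).
    apply: ge0_le_integral => //=.
    - exact: measurable_fun_ysection.
    - exact: emeasurable_funM.
    move=> w' _.
    have := fixed_vector_bound s0 D rLN iZ (mx_at Y w') ct0.
    congr (_ <= _)%E.
      congr (P _); apply/seteqP; split => w; rewrite /ysection/= inE /E/= /X mulmxA//.
    by rewrite -EFinM /k; congr (_%:E); ring.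
  rewrite ge0_integralZl// [X in (_ <= X)%E]EFinM; apply: lee_pmul => //.
    exact: integral_ge0.
  exact: expectation_projection_norm.
move=> kapP; have := le_trans lower; rewrite (integral_xsection_ysection P P mE).
move=> /(_ _ upper) {lower upper}.
have [pS0 pS1] : (0 <= P S)%E /\ P S \is a fin_num by split => //; exact: fin_num_measure.
rewrite -(fineK pS1) -EFinM !lee_fin; move: (fine (P S)) => p.
set nu := spectral_norm _ * _ => hp.
rewrite ler_pdivlMr ?mulr_gt0//.
have ka0 : 0 < kap * al by rewrite mulr_gt0.
have nu0 : 0 <= nu by rewrite mulr_ge0 ?spectral_norm_ge0 ?sqrtr_ge0.
rewrite -(ler_pM2l ka0).
have -> : kap * al * (p * (s * t)) = kap * p * (c * t) by rewrite /c; ring.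
rewrite -ler_pdivlMr//; apply: le_trans hp _.
rewrite ler_pdivlMr//.
have -> : 2 * normal_peak s * spectral_norm (moore_penrose N) / (c * t) *
    (s * Num.sqrt (\rank L)%:R) * (c * t) = 2 * normal_peak s * s * nu.
  by rewrite /nu; field; rewrite !gt_eqF.
have -> : kap * al * (235 / 100 * nu) = 235 / 100 * al * kap * nu by ring.
exact: ler_wpM2r.
Qed.

End Core.

(** * The two rank cases *)

Section GaussianProduct.
Context {R : realType} {d : measure_display} {T : measurableType d}.
Variables (P : probability T R) (s : R).
Hypothesis s0 : 0 < s.

Lemma moore_penrose1 n : moore_penrose (1%:M : 'M[R]_n) = 1%:M.
Proof. by apply: moore_penrose_eq; split; rewrite ?mulmx1 ?trmx1. Qed.

Lemma spectral_norm1_le n : spectral_norm (1%:M : 'M[R]_n) <= 1.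
Proof. by apply: spectral_norm_le => v; rewrite mul1mx. Qed.

Lemma spectral_norm_pinv_tr m n (A : 'M[R]_(m, n)) :
  spectral_norm (moore_penrose A^T) = spectral_norm (moore_penrose A).
Proof. by rewrite moore_penrose_tr spectral_norm_tr. Qed.

Lemma spectral_norm_pinv_gt0 m n (A : 'M[R]_(m, n)) : A != 0 ->
  0 < spectral_norm (moore_penrose A).
Proof.
move=> A0; rewrite lt_def spectral_norm_ge0 andbT; apply: contra_neq A0.
by move=> /spectral_norm_eq0/moore_penrose_eq0.
Qed.

Variables (a b n : nat) (D : 'M[R]_(a.+1, b.+1)) (M : 'M[R]_(b.+1, n)).
Hypothesis M0 : M != 0.
Variable Z : 'I_a.+1 * 'I_b.+1 -> T -> R.
Hypothesis iZ : iid_normal s P Z.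

Let A w : 'M[R]_(a.+1, n) := (D + mx_at Z w) *m M.

Lemma measurable_norm_pinv :
  measurable_fun [set: T] (fun w => spectral_norm (moore_penrose (A w))).
Proof.
have := measurable_spectral_core 1%:M D M iZ.
by congr measurable_fun; apply/funext => w; rewrite mul1mx mulmx1.
Qed.

Lemma norm_pinv_bound t : 0 < t ->
  (P [set w | (t <= spectral_norm (moore_penrose (A w)))%R] <=
   (235 / 100 * (spectral_norm (moore_penrose M) * Num.sqrt (minn a.+1 (\rank M))%:R)
     / (s * t))%R%:E)%E.
Proof.
move=> t0; have nM0 := spectral_norm_pinv_gt0 M0.
have [ra|ra] := leqP a.+1 (\rank M).
  have r1 : (\rank (1%:M : 'M[R]_a.+1) <= \rank M)%N by rewrite mxrank1.
  have := core_bound s0 D r1 iZ t0; rewrite mxrank1.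
  congr (P _ <= _)%E; apply/seteqP; split => w /=; rewrite mul1mx mulmx1//.
pose h (ij : 'I_b.+1 * 'I_a.+1) := (ij.2, ij.1).
have hI : injective h by move=> [i i'] [j j'] [-> ->].
have iZT := iid_normal_comp hI iZ.
have r1 : (\rank M^T <= \rank (1%:M : 'M[R]_a.+1))%N by rewrite mxrank1 mxrank_tr ltnW.
(* The norm of the pseudo-inverse is at most the core norm times |M^+|, so the threshold is divided
   by |M^+|; the factor returns in the final bound in place of |N^+|, since N = 1. *)
have t'0 : 0 < t / spectral_norm (moore_penrose M) by rewrite divr_gt0.
have mC := measurable_superlevel (t / spectral_norm (moore_penrose M))
  (measurable_spectral_core M^T D^T 1%:M iZT).
have := core_bound s0 D^T r1 iZT t'0; rewrite mxrank_tr moore_penrose1 => bd.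
apply: le_trans (le_trans _ bd) _.
  apply: le_measure; rewrite ?inE//; first exact: measurable_superlevel measurable_norm_pinv.
  move=> w /= tA; rewrite ler_pdivrMr//; apply: le_trans tA _.
  rewrite -spectral_norm_pinv_tr -[X in _ <= _ * X]spectral_norm_pinv_tr.
  have -> : (A w)^T = M^T *m (D^T + mx_at (fun j => Z (h j)) w) *m 1%:M.
    rewrite mulmx1 /A trmx_mul; congr (_ *m _).
    by apply/matrixP => i j; rewrite !mxE.
  have := spectral_normM (moore_penrose
      (M^T *m (D^T + mx_at (fun j => Z (h j)) w) *m 1%:M) *m M^T) (moore_penrose M^T).
  by rewrite -[X in moore_penrose X *m _ *m _]mulmxA moore_penrose_mulmxl mulmxA.
rewrite lee_fin ?(minn_idPr (ltnW ra)).
set r := Num.sqrt _; set nu := spectral_norm (moore_penrose M).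
have k0 : 0 <= 235 / 100 * (nu * r) / (s * t).
  by rewrite divr_ge0 ?mulr_ge0 ?sqrtr_ge0// ltW.
have -> : 235 / 100 * (spectral_norm (1%:M : 'M[R]_a.+1) * r) / (s * (t / nu)) =
    235 / 100 * (nu * r) / (s * t) * spectral_norm (1%:M : 'M[R]_a.+1).
  by field; rewrite !gt_eqF.
by rewrite ler_piMr// spectral_norm1_le.
Qed.

(** A vanishing pseudo-inverse means a vanishing product. Row 0 of the Gaussian factor would then
    annihilate a nonzero column of [M], an event inside a ball of radius 0 for a normal variable. *)
Lemma norm_pinv_neq0 : P [set w | spectral_norm (moore_penrose (A w)) = 0] = 0%E.
Proof.
have /existsP[j cj] : [exists j, col j M != 0].
  rewrite -negb_forall; apply: contra M0 => /forallP c0; apply/eqP/matrixP => i j.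
  by have /eqP/colP/(_ i) := c0 j; rewrite !mxE.
have nc : 0 < l2norm (col j M).
  by rewrite lt_def l2norm_ge0 andbT; apply: contra_neq cj; exact: l2norm_eq0.
pose q := (l2norm (col j M))^-1 *: col j M.
have q1 : l2norm q = 1 by rewrite l2normZ ger0_norm ?invr_ge0 ?l2norm_ge0// mulVf ?gt_eqF.
pose h (ij : 'I_b.+1 * 'I_1) : 'I_a.+1 * 'I_b.+1 := (ord0, ij.1).
have hI : injective h by move=> [i i'] [k k'] [->]; rewrite (ord1 i') (ord1 k').
have iY := iid_normal_comp hI iZ; set Y := (fun j => _) in iY.
have := iid_normal_small_ball s0 iY q1 ((D *m q) 0 0) (lexx 0).
rewrite mulr0 => small.
apply/eqP; rewrite eq_le measure_ge0 andbT; apply: le_trans small.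
apply: le_measure; rewrite ?inE.
- rewrite -[X in measurable X]setTI.
  exact: (measurable_norm_pinv measurableT (measurable_set1 0)).
- apply: measurable_sublevel; apply: measurableT_comp; first exact: normr_measurable.
  apply: measurable_funD => //; apply: measurable_dot => i.
  by apply: measurable_mx_at; exact: iY.1.
move=> w /= /spectral_norm_eq0/moore_penrose_eq0 A0.
rewrite (_ : _ + _ = (((D + mx_at Z w) *m q) 0 0)); last first.
  rewrite mulmxDl [RHS]mxE; congr (_ + _); rewrite dotE [RHS]mxE.
  by apply: eq_bigr => i _; rewrite !mxE /= mulrC.
rewrite /q -scalemxAr [X in _ *: (_ *m X)]colE mulmxA -/(A w) A0 mul0mx scaler0.
by rewrite mxE normr0.
Qed.

End GaussianProduct.

(** * From tail bounds to distribution functions *)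

Section GaussianMatrices.
Context {R : realType} {d : measure_display} {T : measurableType d}.
Variable P : probability T R.

(** Since [0^-1] is 0, the event that 1/X is at most y contains X = 0 besides X >= 1/y; the null
    hypothesis disposes of that extra piece. *)
Lemma cdf_recip_rv_le (X : {RV P >-> R}) (K y : R) : (forall w, 0 <= X w) ->
  P [set w | X w = 0] = 0%E ->
  (forall t, 0 < t -> (P [set w | (t <= X w)%R] <= (K / t)%:E)%E) -> 0 <= y ->
  (cdf (recip_rv X) y <= (K * y)%:E)%E.
Proof.
move=> X0 PX0 PXt y0.
have mX0 : measurable [set w | X w = 0].
  have mX : measurable_fun [set: T] X by [].
  by rewrite -[A in measurable A]setTI; exact: (mX measurableT _ (measurable_set1 0)).
have -> : cdf (recip_rv X) y = P [set w | (X w)^-1 <= y].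
  by rewrite /cdf /distribution /pushforward; congr (P _); apply/seteqP; split => w /=;
    rewrite in_itv.
have mXy : measurable [set w | (X w)^-1 <= y].
  exact: measurable_sublevel (measurable_mfunV X).
(* At y = 0 there is no threshold 1/y, and the event is just X = 0. *)
have [->|yn0] := eqVneq y 0.
  apply: (@le_trans _ _ (P [set w | X w = 0])); last by rewrite PX0 mulr0.
  apply: le_measure; rewrite ?inE//.
    exact: measurable_sublevel (measurable_mfunV X).
  by move=> w /=; rewrite invr_le0 => Xw; apply/eqP; rewrite eq_le Xw X0.
have {}y0 : 0 < y by rewrite lt_def yn0.
have yV : 0 < y^-1 by rewrite invr_gt0.
have mt : measurable [set w | y^-1 <= X w] by exact: measurable_superlevel.
apply: (@le_trans _ _ (P ([set w | X w = 0] `|` [set w | y^-1 <= X w]))).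
  apply: le_measure; rewrite ?inE//; first exact: measurableU.
  move=> w /= Xy; have [Xw|Xw] := eqVneq (X w) 0; [by left|right => /=].
  by rewrite -[X w]invrK lef_pV2 ?posrE// invr_gt0 lt_def Xw X0.
rewrite (le_trans (measureU2 _ _ _))//= PX0 add0e.
by have := PXt _ yV; rewrite invrK.
Qed.

Lemma cdf_recip_rv_tail (X : {RV P >-> R}) (f : T -> R) (K x y : R) :
  (forall w, X w = f w) -> (forall w, 0 <= f w) -> P [set w | f w = 0] = 0%E ->
  (forall t, 0 < t -> (P [set w | (t <= f w)%R] <= (K / t)%:E)%E) ->
  0 < K -> 0 < x -> 0 <= y ->
  (cdf (recip_rv X) y <= (K * y)%:E)%E /\
  (P [set w | (K * x <= X w)%R] <= (x^-1)%:E)%E.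
Proof.
move=> /funext <- X0 PX0 PXt K0 x0 y0; split; first exact: cdf_recip_rv_le.
have := PXt _ (mulr_gt0 K0 x0).
by rewrite invfM mulrA divff ?gt_eqF// mul1r.
Qed.

(** The product MH is the transpose of H^T M^T, and transposition preserves the norm of the
    pseudo-inverse, so the bound for GM covers both products. *)
Lemma gaussian_matrix_tr a b (mu s : R) (G : 'M[{RV P >-> R}]_(a, b)) :
  gaussian_matrix mu s G -> gaussian_matrix mu s G^T.
Proof.
move=> [indep law]; split; last by move=> i j B mB; rewrite mxE; exact: law.
pose sw m n (ij : 'I_m * 'I_n) := (ij.2, ij.1).
have swK m n : cancel (@sw m n) (@sw n m) by case.
move=> J B mB; pose J' := [set sw _ _ ij | ij in J]%SET.
have mB' ij : ij \in J' -> measurable (B (sw _ _ ij)).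
  by move=> /imsetP[ij' ijJ ->]; rewrite swK; exact: mB.
have := indep J' (fun ij => B (sw _ _ ij)) mB'.
rewrite big_imset/=; last by move=> ij ij' _ _; exact: (can_inj (@swK b a)).
rewrite (eq_bigr (fun ij => P (G^T ij.1 ij.2 @^-1` B ij))) => [<-|ij _]; last first.
  by rewrite swK mxE.
congr (P _); apply/seteqP; split => w /= h ij ijJ.
  case/imsetP: ijJ => ij' ijJ' ->; rewrite swK.
  by have := h ij' ijJ'; rewrite mxE.
by have := h (sw _ _ ij) (imset_f _ ijJ); rewrite swK mxE.
Qed.

Lemma gaussian_norm_pinv a b n (mu s : R) (G : 'M[{RV P >-> R}]_(a, b))
    (D : 'M[R]_(a, b)) (M : 'M[R]_(b, n)) : (0 < a)%N -> (0 < b)%N -> 0 < s ->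
  M != 0 -> gaussian_matrix mu s G ->
  let X w := spectral_norm (moore_penrose ((realize G w + D) *m M)) in
  P [set w | X w = 0] = 0%E /\
  forall t, 0 < t -> (P [set w | (t <= X w)%R] <=
    (235 / 100 * Num.sqrt (minn a (\rank M))%:R * spectral_norm (moore_penrose M)
      / s / t)%:E)%E.
Proof.
case: a b G D M => [|a] [|b] G D M// _ _ s0 M0 gG X.
have iZ := gaussian_matrix_iid s0 gG.
set Z := (fun ij => _) in iZ.
have GE w : realize G w + D = D + const_mx mu + mx_at Z w.
  by apply/matrixP => i j; rewrite !mxE /Z/=; ring.
have XE w : X w = spectral_norm (moore_penrose ((D + const_mx mu + mx_at Z w) *m M)).
  by rewrite /X GE.
have -> : X = (fun w => spectral_norm (moore_penrose ((D + const_mx mu + mx_at Z w) *m M))).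
  exact/funext.
split=> [|t t0]; first exact: (norm_pinv_neq0 s0 (D + const_mx mu) M0 iZ).
have := norm_pinv_bound s0 (D + const_mx mu) M0 iZ t0.
set r := Num.sqrt _; set nu := spectral_norm _.
rewrite (_ : 235 / 100 * (nu * r) / (s * t) = 235 / 100 * r * nu / s / t) => [h|].
  exact: h.
by rewrite invfM; ring.
Qed.

End GaussianMatrices.

Theorem theorem4p1 (R : realType) (d : measure_display) (T : measurableType d)
    (P : probability T R) (m n r : nat) (mu sigma x y : R) (M : 'M[R]_(m, n))
    (G' : 'M[{RV P >-> R}]_(r, m)) (H' : 'M[{RV P >-> R}]_(n, r))
    (U : 'M[R]_(r, m)) (V : 'M[R]_(n, r)) :
  (0 < m)%N -> (0 < n)%N -> (0 < r)%N -> 0 < sigma -> 0 < x -> 0 <= y ->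
  M != 0 ->
  gaussian_matrix mu sigma G' -> gaussian_matrix mu sigma H' ->
  let G : 'M[{RV P >-> R}]_(r, m) := G' + const_rmx P U in
  let H : 'M[{RV P >-> R}]_(n, r) := H' + const_rmx P V in
  let GM : 'M[{RV P >-> R}]_(r, n) := G *m const_rmx P M in
  let MH : 'M[{RV P >-> R}]_(m, r) := const_rmx P M *m H in
  let rhat := minn r (\rank M) in
  let bound (t : R) : R :=
    235 / 100 * t * Num.sqrt rhat%:R * spectral_norm (moore_penrose M) / sigma in
  [/\ (cdf (recip_rv (norm_pinv_rv GM)) y <= (bound y)%:E)%E,
      (cdf (recip_rv (norm_pinv_rv MH)) y <= (bound y)%:E)%E,
      (P [set w | (bound x <= norm_pinv_rv GM w)%R] <= (x^-1)%:E)%E &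
      (P [set w | (bound x <= norm_pinv_rv MH w)%R] <= (x^-1)%:E)%E].
Proof.
move=> m0 n0 r0 s0 x0 y0 M0 gG gH G H GM MH rhat bound.
pose K := 235 / 100 * Num.sqrt rhat%:R * spectral_norm (moore_penrose M) / sigma.
have boundE t : bound t = K * t by rewrite /bound /K; ring.
have K0 : 0 < K.
  apply: divr_gt0 s0; apply: mulr_gt0 (spectral_norm_pinv_gt0 M0).
  apply: mulr_gt0; first by lra.
  by rewrite sqrtr_gt0 ltr0n /rhat leq_min r0 lt0n mxrank_eq0.
have GME w : norm_pinv_rv GM w =
    spectral_norm (moore_penrose ((realize G' w + U) *m M)).
  by rewrite norm_pinv_rvE /GM realizeM realizeD !realize_const_rmx.
have HT : gaussian_matrix mu sigma H'^T by exact: gaussian_matrix_tr.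
have MHE w : norm_pinv_rv MH w =
    spectral_norm (moore_penrose ((realize H'^T w + V^T) *m M^T)).
  rewrite norm_pinv_rvE /MH realizeM realizeD !realize_const_rmx.
  have -> : realize H'^T w + V^T = (realize H' w + V)^T.
    by apply/matrixP => i j; rewrite !mxE.
  by rewrite -trmx_mul spectral_norm_pinv_tr.
have MT0 : M^T != 0 by apply: contra_neq M0 => h; rewrite -[M]trmxK h trmx0.
have [G0 Gt] := gaussian_norm_pinv U r0 m0 s0 M0 gG.
have [H0 Ht] := gaussian_norm_pinv V^T r0 n0 s0 MT0 HT.
rewrite mxrank_tr spectral_norm_pinv_tr -/rhat -/K in Ht.
rewrite -/rhat -/K in Gt.
have [G1 G2] := cdf_recip_rv_tail GME (fun=> spectral_norm_ge0 _) G0 Gt K0 x0 y0.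
have [H1 H2] := cdf_recip_rv_tail MHE (fun=> spectral_norm_ge0 _) H0 Ht K0 x0 y0.
by rewrite !boundE; split.
Qed.
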